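(* Let $K$ be a finite simplicial complex and let $m$ be the number of simplices of $K$. The complexity of the incremental algorithm described in the context, which takes as input the simplices of $K$ sorted as $\sigma_1,\dots,\sigma_m$ so that every initial segment $\{\sigma_1,\dots,\sigma_i\}$, $i\le m$, is a simplicial complex, and which computes the homology $H_*K$ over $\mathbf{Z}_2$ together with a chain contraction $(f,g,\phi)$ from $C_*K$ to $H_*K$, is $O(m^3)$.
   Context: All coefficients are in $\mathbf{Z}_2$. $C_*K$ is the simplicial chain complex of $K$: $C_qK$ is the $\mathbf{Z}_2$-vector space with basis the $q$-simplices of $K$, with $\partial\langle v_0,\dots,v_q\rangle=\sum_{i=0}^q\langle v_0,\dots,\hat v_i,\dots,v_q\rangle$. $H_*K$ is its homology, regarded as a chain complex with zero differential. Chain contraction. A chain contraction $(f,g,\phi)$ from a chain complex $C_*$ to a chain complex $D_*$ consists of chain maps $f:C_*\to D_*$ and $g:D_*\to C_*$ and a family of homomorphisms $\phi=\{\phi_q:C_q\to C_{q+1}\}$ such that $fg=1_{D_*}$, $\;1_{C_*}+gf=\partial\phi+\phi\partial$, $\;f\phi=0$, $\;\phi g=0$ and $\phi\phi=0$. The algorithm. It maintains a list $\ell$ of triples $(\tau,f[\tau,\ell],\phi[\tau,\ell])$, where $\tau$ is a simplex, $f[\tau,\ell]$ is a $\mathbf{Z}_2$-linear combination of simplices (''generators''), and $\phi[\tau,\ell]$ is a $\mathbf{Z}_2$-linear combination of simplices and of formal symbols $\phi\sigma$ ($\sigma$ a simplex). If no triple of $\ell$ has first element $\tau$, then $f[\tau,\ell]=0$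 and $\phi[\tau,\ell]=0$. Both $f[\cdot,\ell]$ and $\phi[\cdot,\ell]$ are extended linearly to chains. Initially $\ell=\emptyset$. For $i=1,\dots,m$: (1) If $f[\partial\sigma_i,\ell]=0$, the triple $(\sigma_i,\sigma_i,\phi\sigma_i)$ is added to $\ell$, where $\phi\sigma_i$ is a new formal symbol. (2) Otherwise, the equation $f[\partial\sigma_i,\ell]=0$ is solved for one of the generators $\sigma_j$ occurring in it, and the solution is substituted for $\sigma_j$ in all second elements of the triples of $\ell$; and the equation $\phi[\partial\sigma_i,\ell]=\sigma_i$ is solved for the corresponding formal symbol $\phi\sigma_j$, and the solution is substituted for $\phi\sigma_j$ in all third elements of the triples of $\ell$. (No triple is added for $\sigma_i$, so $f\sigma_i=0$ and $\phi\sigma_i=0$.) After step $m$, all remaining formal symbols $\phi\sigma$ are replaced by $0$. The resulting list gives $f$ and $\phi$ on all simplices: the image of $\tau$ under $f$ (respectively $\phi$) is the second (respectively third) element of the triple starting with $\tau$, and is $0$ if there is no such triple. The simplices $\tau$ with $f\tau=\tau$ are the generators of homology, i.e. they form a basis representing $H_*K$. For each such $\tau$ the algorithm computes the representative cycle $g\tau=\tau+\phi\partial\tau$, which defines $g$. Complexity means the worst-case number of elementary operations, as a function of $m$. *)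

(* Defs.v *)
From HB Require Import structures.
From mathcomp Require Import all_boot all_order all_algebra.
From mathcomp Require Import generic_quotient ring_quotient.

Set Implicit Arguments.
Unset Strict Implicit.
Unset Printing Implicit Defensive.

Import GRing.Theory.
Local Open Scope ring_scope.

Section QuotientSpace.
Variables (F : fieldType) (V : vectType F) (U : {vspace V}).
Local Open Scope quotient_scope.

Definition vquot : Type := Quotient.quot U.
HB.instance Definition _ := GRing.Zmodule.on vquot.

Definition vquot_pi (x : V) : vquot := \pi_(Quotient.quot U) x.

Lemma vquot_piK (x : Quotient.quot U) : vquot_pi (repr x) = x.
Proof. exact: reprK. Qed.

Lemma vquot_piP x y : (vquot_pi x == vquot_pi y) = (x - y \in U).
Proof. by rewrite Quotient.idealrBE. Qed.

Lemma vquot_piD x y : vquot_pi (x + y) = vquot_pi x + vquot_pi y.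
Proof. by rewrite /vquot_pi piE. Qed.

Definition vquot_scale (a : F) (x : vquot) : vquot :=
  vquot_pi (a *: repr (x : Quotient.quot U)).

Lemma vquot_piZ a x : vquot_pi (a *: x) = vquot_scale a (vquot_pi x).
Proof.
apply/eqP; rewrite vquot_piP -scalerBr memvZ // -vquot_piP.
by rewrite vquot_piK.
Qed.

Fact vquot_scaleA a b x : vquot_scale a (vquot_scale b x) = vquot_scale (a * b) x.
Proof. by rewrite -[x]vquot_piK -!vquot_piZ scalerA. Qed.
Fact vquot_scale1 : left_id 1 vquot_scale.
Proof. by move=> x; rewrite -[x]vquot_piK -!vquot_piZ scale1r. Qed.
Fact vquot_scaleDr : right_distributive vquot_scale +%R.
Proof.
by move=> a x y; rewrite -[x]vquot_piK -[y]vquot_piK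
  -!(vquot_piD, vquot_piZ) scalerDr.
Qed.
Fact vquot_scaleDl x : {morph vquot_scale^~ x : a b / a + b}.
Proof.
by move=> a b /=; rewrite -[x]vquot_piK -!(vquot_piD, vquot_piZ) scalerDl.
Qed.
HB.instance Definition _ := GRing.Zmodule_isLmodule.Build F vquot
  vquot_scaleA vquot_scale1 vquot_scaleDr vquot_scaleDl.

Fact vquot_pi_linear : linear vquot_pi.
Proof. by move=> a x y; rewrite vquot_piD vquot_piZ. Qed.
HB.instance Definition _ := GRing.isLinear.Build F V vquot _ vquot_pi
  vquot_pi_linear.

Fact vquot_axiom : Vector.axiom (\dim (U^C)) vquot.
Proof.
pose p (x : V) : subvs_of (U^C)%VS := vsproj _ (x - projv U x).
have pE x : vsval (p x) = x - projv U x by rewrite vsprojK ?memv_projC.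
have p0 x : x \in U -> p x = 0.
  by move=> Ux; apply/val_inj; rewrite /= pE projv_id ?subrr.
have plin : linear p.
  by move=> a x y; apply/val_inj; rewrite /= !pE linearP opprD addrACA scalerBr.
have pB x y : p (x - y) = p x - p y.
  by rewrite addrC -scaleN1r plin scaleN1r addrC.
have ppi x : p (repr (vquot_pi x : Quotient.quot U)) = p x.
  by apply/eqP; rewrite -subr_eq0 -pB p0 // -vquot_piP vquot_piK.
have [h hlin hbij] := subvs_vect_iso (U^C)%VS.
exists (fun x : vquot => h (p (repr (x : Quotient.quot U)))).
  by move=> a x y; rewrite -[x]vquot_piK -[y]vquot_piK -linearP !ppi plin hlin.
case: hbij => h' hK h'K; exists (fun r => vquot_pi (vsval (h' r))) => [x | r].
  rewrite hK pE; apply/eqP; rewrite -[x in _ == x]vquot_piK vquot_piP.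
  by rewrite addrAC subrr add0r memvN memv_proj.
rewrite ppi -[RHS]h'K; congr h; apply/val_inj; rewrite /= pE.
have : projv U (vsval (h' r)) == 0.
  by rewrite -memv_ker lker_proj subvsP.
by move/eqP->; rewrite subr0.
Qed.
HB.instance Definition _ := Lmodule_hasFinDim.Build F vquot vquot_axiom.

End QuotientSpace.

(* Nonnegatively graded complexes of finite-dimensional vector spaces;
   [bd C q] is the differential C_{q+1} -> C_q, and that on C_0 is zero. *)
Record chain_complex := ChainComplex {
  chains :> nat -> vectType 'F_2;
  bd : forall q, {linear chains q.+1 -> chains q};
  bdK : forall q (x : chains q.+2), bd q (bd q.+1 x) = 0
}.

Definition graded_map (C D : chain_complex) := forall q, {linear C q -> D q}.

Definition is_chain_map (C D : chain_complex) (f : graded_map C D) :=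
  forall q (x : C q.+1), f q (bd C q x) = bd D q (f q.+1 x).

Definition homotopy_on (C : chain_complex) := forall q, {linear C q -> C q.+1}.

Definition homotopy_bd (C : chain_complex) (phi : homotopy_on C) (q : nat) :
    C q -> C q :=
  match q with
  | 0%N => fun=> 0
  | q'.+1 => fun x => phi q' (bd C q' x)
  end.

Record is_chain_contraction (C D : chain_complex)
    (f : graded_map C D) (g : graded_map D C) (phi : homotopy_on C) : Prop := {
  contraction_f : is_chain_map f;
  contraction_g : is_chain_map g;
  contraction_fg : forall q (y : D q), f q (g q y) = y;
  contraction_gf : forall q (x : C q),
    x + g q (f q x) = bd C q (phi q x) + homotopy_bd phi x;
  contraction_fphi : forall q (x : C q), f q.+1 (phi q x) = 0;
  contraction_phig : forall q (y : D q), phi q (g q y) = 0;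
  contraction_phiphi : forall q (x : C q), phi q.+1 (phi q x) = 0
}.

Section Homology.
Variable C : chain_complex.

Definition cycles (q : nat) : {vspace C q} :=
  match q with
  | 0%N => fullv
  | q'.+1 => lker (linfun (bd C q'))
  end.

Definition cycle_space (q : nat) : vectType 'F_2 := subvs_of (cycles q).

Definition boundaries (q : nat) : {vspace cycle_space q} :=
  (linfun (vsval : cycle_space q -> C q) @^-1: limg (linfun (bd C q)))%VS.

Definition homology_space (q : nat) : vectType 'F_2 := vquot (boundaries q).

Definition hclass (q : nat) (z : cycle_space q) : homology_space q :=
  vquot_pi (boundaries q) z.

Definition zero_differential (q : nat) :
    {linear homology_space q.+1 -> homology_space q} := \0.

Definition homology : chain_complex :=
  @ChainComplex homology_space zero_differential (fun _ _ => erefl).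

End Homology.

Section Simplicial.
Variable V : finType.

Definition is_complex (K : {set {set V}}) : Prop :=
  set0 \notin K /\
  forall s t : {set V}, s \in K -> t \subset s -> t != set0 -> t \in K.

Record simplicial_complex := SimplicialComplex {
  simplices :> {set {set V}};
  simplicesP : is_complex simplices
}.

Variable K : simplicial_complex.

Definition simplex (q : nat) :=
  {s : {set V} | (s \in simplices K) && (#|s| == q.+1)}.

Definition verts q (x : simplex q) : {set V} := val x.

Definition schain (q : nat) : vectType 'F_2 := {ffun simplex q -> ('F_2)^o}.

Definition basis_chain q (x : simplex q) : schain q :=
  [ffun y => (y == x)%:R].

Definition simplex_bd q (x : simplex q.+1) : schain q :=
  [ffun y => \sum_(v in verts x) (verts y == verts x :\ v)%:R].

Definition chain_bd q (c : schain q.+1) : schain q :=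
  \sum_x c x *: simplex_bd x.

Fact chain_bd_linear q : linear (@chain_bd q).
Proof.
move=> a b c; rewrite scaler_sumr -big_split; apply: eq_bigr => x _ /=.
by rewrite !ffunE scalerDl scalerA.
Qed.
HB.instance Definition _ q := GRing.isLinear.Build 'F_2 (schain q.+1) (schain q)
  _ (@chain_bd q) (@chain_bd_linear q).

Lemma chain_bdK q (c : schain q.+2) : chain_bd (chain_bd c) = 0.
Proof.
have char2 (a : 'F_2) : a + a = 0 by exact: (addrr_pchar2 (pchar_Fp _)).
rewrite [chain_bd c]/chain_bd linear_sum big1 // => x _.
rewrite linearZ /=; have -> : chain_bd (simplex_bd x) = 0; last by rewrite scaler0.
apply/ffunP=> z; rewrite [RHS]ffunE /chain_bd sum_ffunE.
pose G v w : 'F_2 := (verts z == verts x :\ v :\ w)%:R.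
transitivity (\sum_(v in verts x) \sum_(w in verts x :\ v) G v w).
  transitivity (\sum_(y : simplex q.+1) \sum_(v in verts x)
      if verts y == verts x :\ v then \sum_(w in verts x :\ v) G v w else 0).
    apply: eq_bigr => y _; rewrite !ffunE -[_ *: _]/(_ * _) mulr_suml; apply: eq_bigr => v _.
    rewrite /G; case: eqP => [<- | _]; last by rewrite mul0r.
    by rewrite mul1r.
  rewrite exchange_big; apply: eq_bigr => v xv /=; rewrite -big_mkcond /=.
  have /andP[Kx /eqP szx] : (verts x \in simplices K) && (#|verts x| == q.+3) := valP x.
  have szf : #|verts x :\ v| = q.+2 by move: szx; rewrite (cardsD1 v) xv => -[].
  have Kf : (verts x :\ v \in simplices K) && (#|verts x :\ v| == q.+2).
    rewrite szf eqxx andbT; apply: (simplicesP K).2 Kx _ _; first exact: subD1set.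
    by rewrite -card_gt0 szf.
  by rewrite (big_pred1 (@exist _ (fun s : {set V} =>
    (s \in simplices K) && (#|s| == q.+2)) _ Kf : simplex q.+1)).
have G_C v w : G v w = G w v by rewrite /G setDDl setDDl setUC.
pose H v w : 'F_2 := if (v \in verts x) && (w \in verts x) then G v w else 0.
have HC v w : H v w = H w v by rewrite /H andbC G_C.
transitivity (\sum_v \sum_w if (enum_rank v < enum_rank w)%N then H v w + H w v else 0).
  transitivity (\sum_v \sum_(w | w != v) H v w).
    rewrite big_mkcond; apply: eq_bigr => v _ /=; rewrite /H.
    case: (v \in verts x) => /=; last by rewrite big1.
    rewrite big_mkcond [RHS]big_mkcond; apply: eq_bigr => w _ /=.
    by rewrite !inE; case: (w == v) => /=; case: (w \in verts x).
  transitivity (\sum_v \sum_w ((if (enum_rank v < enum_rank w)%N then H v w else 0)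
       + (if (enum_rank w < enum_rank v)%N then H v w else 0))).
    apply: eq_bigr => v _; rewrite big_mkcond; apply: eq_bigr => w _ /=.
    rewrite -(inj_eq enum_rank_inj) -val_eqE /=.
    by case: ltngtP; rewrite ?addr0 ?add0r.
  under eq_bigr => v _ do rewrite big_split /=.
  rewrite big_split /= [X in _ + X]exchange_big /= -big_split /=.
  apply: eq_bigr => v _; rewrite -big_split; apply: eq_bigr => w _ /=.
  by case: ifP => _; rewrite ?addr0.
by rewrite big1 // => v _; rewrite big1 // => w _; rewrite HC char2; case: ifP.
Qed.

Definition simplicial_chains : chain_complex :=
  @ChainComplex schain (fun q => @chain_bd q) chain_bdK.

Definition sorted_simplices (s : seq {set V}) : Prop :=
  [/\ uniq s, s =i simplices K &
      forall i, (i <= size s)%N -> is_complex [set x in take i s]].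

End Simplicial.

(* A computation returns a value together with the number of elementary
   operations performed.  The model is list processing at unit cost.  The
   elementary operations, each charged by one [op] or [charge], are: comparing
   two vertices or two indices, adding two coefficients in Z_2, incrementing an
   index, selecting a generator, building a list cell or a triple, and
   inspecting a list cell (one step of a loop).  There is no random access: the
   j-th coefficient of a chain is reached by walking along its list.  Only
   branching on an already computed bit or option and (un)packing tuples is
   free; between two charged operations there is boundedly much of it. *)
Definition timed (A : Type) : Type := (A * nat)%type.
Definition result A (p : timed A) : A := p.1.
Definition cost A (p : timed A) : nat := p.2.

Definition ret A (x : A) : timed A := (x, 0%N).
Definition op A (x : A) : timed A := (x, 1%N).
Definition bind A B (p : timed A) (k : A -> timed B) : timed B :=
  (result (k (result p)), (cost p + cost (k (result p)))%N).
Definition charge A (p : timed A) : timed A := bind (op tt) (fun=> p).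

Notation "'do' x <- p ;; q" := (bind p (fun x => q))
  (at level 200, x name, p at level 100, q at level 200, right associativity,
   format "'[v' 'do'  x  <-  p  ;; '/' q ']'").

Section Loops.
Variables A B : Type.

Fixpoint mapT (h : A -> timed B) (s : seq A) : timed (seq B) :=
  if s is x :: s' then
    do y <- h x ;;
    do t <- mapT h s' ;;
    op (y :: t)
  else op [::].

Fixpoint foldT (h : A -> B -> timed B) (acc : B) (s : seq A) : timed B :=
  if s is x :: s' then
    charge (do acc' <- h x acc ;; foldT h acc' s')
  else op acc.

Fixpoint filterT (p : A -> timed bool) (s : seq A) : timed (seq A) :=
  if s is x :: s' then
    do b <- p x ;;
    do t <- filterT p s' ;;
    op (if b then x :: t else t)
  else op [::].

Fixpoint numberT (i : nat) (s : seq A) : timed (seq (nat * A)) :=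
  if s is x :: s' then
    do i' <- op i.+1 ;;
    do t <- numberT i' s' ;;
    op ((i, x) :: t)
  else op [::].

End Loops.

Fixpoint seq_eqT (T : eqType) (s t : seq T) : timed bool :=
  match s, t with
  | [::], [::] => op true
  | x :: s', y :: t' =>
      do e <- op (x == y) ;;
      if e then charge (seq_eqT s' t') else ret false
  | _, _ => op false
  end.

Fixpoint addT (u v : bitseq) : timed bitseq :=
  match u, v with
  | a :: u', b :: v' =>
      do c <- op (a (+) b) ;;
      do w <- addT u' v' ;;
      op (c :: w)
  | _, _ => op [::]
  end.

Fixpoint coefT (u : bitseq) (j : nat) : timed bool :=
  match u, j with
  | [::], _ => op false
  | a :: _, 0%N => op a
  | _ :: u', j'.+1 => charge (coefT u' j')
  end.

Fixpoint clearT (u : bitseq) (j : nat) : timed bitseq :=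
  match u, j with
  | [::], _ => op [::]
  | _ :: u', 0%N => op (false :: u')
  | a :: u', j'.+1 => do w <- clearT u' j' ;; op (a :: w)
  end.

(* The indices, counted from i, of the nonzero coefficients. *)
Fixpoint supportT (i : nat) (u : bitseq) : timed (seq nat) :=
  if u is a :: u' then
    do i' <- op i.+1 ;;
    do t <- supportT i' u' ;;
    op (if a then i :: t else t)
  else op [::].

(* The simplices are sigma_0, ..., sigma_{m-1}.  A triple (tau, f tau, phi tau)
   contains the index of tau; the coefficients of f tau on the sigma_k; and the
   coefficients of phi tau on the sigma_k ([phi_of]) and on the formal symbols
   phi sigma_k ([sym_of]). *)
Record triple := Triple {
  simp_of : nat;
  f_of : bitseq;
  phi_of : bitseq;
  sym_of : bitseq
}.

Section Algorithm.
Variable V : eqType.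

(* [pick i js] is the index of the generator that is eliminated at step i,
   where js lists the indices of the generators that occur in the equation. *)
Variable pick : nat -> seq nat -> nat.

(* A simplex is presented as the list of its vertices, in an order fixed for
   the whole complex, and comes with its index. *)
Local Notation input := (seq (nat * seq V)).

Definition faceT (sigma : seq V) (v : V) : timed (seq V) :=
  filterT (fun w => op (w != v)) sigma.

(* The indices of the simplices that occur in the boundary of sigma. *)
Definition boundaryT (inp : input) (sigma : seq V) : timed (seq nat) :=
  foldT (fun v acc =>
    do face <- faceT sigma v ;;
    foldT (fun p acc' =>
      do e <- seq_eqT face p.2 ;;
      if e then op (p.1 :: acc') else ret acc') acc inp) [::] sigma.

Definition zeroT (inp : input) : timed bitseq := mapT (fun=> op false) inp.

Definition unitT (inp : input) (i : nat) : timed bitseq :=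
  mapT (fun p => op (p.1 == i)) inp.

Fixpoint lookupT (tau : nat) (l : seq triple) : timed (option triple) :=
  if l is t :: l' then
    do e <- op (simp_of t == tau) ;;
    if e then ret (Some t) else charge (lookupT tau l')
  else op None.

(* f[c,l], and the two parts of phi[c,l], for the chain c that is the sum of
   the simplices with index in b. *)
Definition evalT (inp : input) (l : seq triple) (b : seq nat) :
    timed (bitseq * bitseq * bitseq) :=
  do z <- zeroT inp ;;
  foldT (fun tau (acc : bitseq * bitseq * bitseq) =>
    do ot <- lookupT tau l ;;
    if ot is Some t then
      do u <- addT acc.1.1 (f_of t) ;;
      do v <- addT acc.1.2 (phi_of t) ;;
      do w <- addT acc.2 (sym_of t) ;;
      op (u, v, w)
    else ret acc) (z, z, z) b.

(* Substitute the chain fsol for the generator sigma_j in the second element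
   of t, and (psol, ssol) for the symbol phi sigma_j in the third one. *)
Definition substT (j : nat) (fsol psol ssol : bitseq) (t : triple) :
    timed triple :=
  do a <- coefT (f_of t) j ;;
  do u <- (if a then do u0 <- clearT (f_of t) j ;; addT u0 fsol
           else ret (f_of t)) ;;
  do b <- coefT (sym_of t) j ;;
  if b then
    do v <- addT (phi_of t) psol ;;
    do w0 <- clearT (sym_of t) j ;;
    do w <- addT w0 ssol ;;
    op (Triple (simp_of t) u v w)
  else op (Triple (simp_of t) u (phi_of t) (sym_of t)).

(* In the second case, sigma_j is expressed by the other terms of f[bd, l] = 0,
   and phi sigma_j by sigma_i and the other terms of phi[bd, l] = sigma_i. *)
Definition stepT (inp : input) (i_sigma : nat * seq V) (l : seq triple) :
    timed (seq triple) :=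
  let: (i, sigma) := i_sigma in
  do b <- boundaryT inp sigma ;;
  do e <- evalT inp l b ;;
  do js <- supportT 0 e.1.1 ;;
  do sigma_i <- unitT inp i ;;
  if js is [::] then
    do z <- zeroT inp ;;
    op (Triple i sigma_i z sigma_i :: l)
  else
    do j <- op (pick i js) ;;
    do fsol <- clearT e.1.1 j ;;
    do psol <- addT e.1.2 sigma_i ;;
    do ssol <- clearT e.2 j ;;
    mapT (substT j fsol psol ssol) l.

(* The representative cycles g tau = tau + phi (boundary tau), with the index of
   tau, for all tau with f tau = tau. *)
Definition cyclesT (inp : input) (l : seq triple) :
    timed (seq (nat * bitseq)) :=
  foldT (fun p acc =>
    do ot <- lookupT p.1 l ;;
    if ot is Some t then
      do tau <- unitT inp p.1 ;;
      do e <- seq_eqT (f_of t) tau ;;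
      if e then
        do b <- boundaryT inp p.2 ;;
        do c <- evalT inp l b ;;
        do w <- addT tau c.1.2 ;;
        op ((p.1, w) :: acc)
      else ret acc
    else ret acc) [::] inp.

Definition algorithm (simplices : seq (seq V)) :
    timed (seq triple * seq (nat * bitseq)) :=
  do inp <- numberT 0 simplices ;;
  do l <- foldT (stepT inp) [::] inp ;;
  do l0 <- mapT (fun t => do z <- zeroT inp ;;
                          op (Triple (simp_of t) (f_of t) (phi_of t) z)) l ;;
  do g <- cyclesT inp l0 ;;
  ret (l0, g).

End Algorithm.

Definition valid_pick (pick : nat -> seq nat -> nat) : Prop :=
  forall i js, js != [::] -> pick i js \in js.

Section Output.
Variables (V : finType) (K : simplicial_complex V) (s : seq {set V}).
Variable r : seq triple * seq (nat * bitseq).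

Definition coefficient q (c : schain K q) (x : simplex K q) : 'F_2 :=
  (c : {ffun simplex K q -> ('F_2)^o}) x.

(* Coefficients with respect to all simplices, of any dimension. *)
Definition chain_bits q (c : schain K q) : bitseq :=
  [seq oapp (coefficient c) 0 (insub t : option (simplex K q)) != 0 | t <- s].

Definition image_bits (part : triple -> bitseq) q (x : simplex K q) : bitseq :=
  if [seq t <- r.1 | simp_of t == index (verts x) s] is t :: _ then part t
  else nseq (size s) false.

Definition g_bits q (x : simplex K q) : seq bitseq :=
  [seq p.2 | p <- r.2 & p.1 == index (verts x) s].

Definition is_generator q (x : simplex K q) : bool :=
  image_bits f_of x == chain_bits (basis_chain x).

Local Notation C := (simplicial_chains K).
Local Notation H := (homology C).

(* The algorithm expresses f x as a combination of generators y; such a y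
   stands for the homology class of its representative cycle [z y]. *)
Record represents (f : graded_map C H) (g : graded_map H C)
    (phi : homotopy_on C) (fgen : forall q, simplex K q -> schain K q)
    (z : forall q, simplex K q -> cycle_space C q) : Prop := {
  represents_fgen : forall q (x : simplex K q),
    image_bits f_of x = chain_bits (fgen q x);
  represents_fgen_supp : forall q (x y : simplex K q),
    coefficient (fgen q x) y != 0 -> is_generator y;
  represents_f : forall q (x : simplex K q),
    f q (basis_chain x) =
    \sum_(y | is_generator y) coefficient (fgen q x) y *: hclass (z q y);
  represents_phi : forall q (x : simplex K q),
    image_bits phi_of x = chain_bits (phi q (basis_chain x));
  represents_z : forall q (y : simplex K q),
    g_bits y = if is_generator y then [:: chain_bits (vsval (z q y))] else [::];
  represents_g : forall q (y : simplex K q),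
    is_generator y -> g q (hclass (z q y)) = vsval (z q y);
  represents_basis : forall q,
    basis_of fullv [seq hclass (z q y) | y <- enum (@is_generator q)]
}.

Definition computes_homology_contraction : Prop :=
  exists f g phi fgen z,
    is_chain_contraction f g phi /\ represents f g phi fgen z.

End Output.

Definition simplex_lists (V : finType) (s : seq {set V}) : seq (seq V) :=
  [seq enum (t : {set V}) | t <- s].

(* Main.v *)
Require Import Defs.
From HB Require Import structures.
From mathcomp Require Import all_boot all_order all_algebra.
From mathcomp Require Import generic_quotient ring_quotient zify.

(** Order the simplices as sigma_0, ..., sigma_(m-1), and let d be the boundary,
f and phi the two maps stored in the list, all linear maps on the span W_i of
the first i simplices.  Call a simplex tau with f tau = tau a generator.

The formal symbols only copy f: at all times the symbolic part of phi tau is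
the sum of the symbols phi sigma_k over the generators sigma_k in f tau.  Both
start as unit vectors, and the two substitutions of a step act on them in the
same way.  So the symbol-free part of phi is meaningful at every step, and one
step of the algorithm is a rank one update.  If sigma_i is the next simplex, put
a = f d sigma_i and b = sigma_i + phi d sigma_i.  When a = 0, sigma_i becomes a
generator.  Otherwise sigma_j is chosen in the support of a, and
   f' x = f x + (f x)_j a,    phi' x = phi x + (f x)_j b
on W_(i+1), where f and phi vanish on sigma_i.  The record
[partial_contraction] collects identities on W_i that such a step preserves
([pc_new_generator], [pc_eliminate]): f d = 0, f phi = phi f = phi phi = 0, f x
is a sum of generators, and x + f x + phi d f x = d phi x + phi d x.

On the whole complex these identities give d phi d = d, phi d phi = phi and
phi phi = 0.  By [splitting_homotopy_contraction] any such phi is the homotopy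
of a contraction onto homology: P = 1 + d phi + phi d is a chain map that
projects onto a complement of the boundaries in the cycles, x goes to the class
of P x, and the class of a cycle z goes to P z.  On a generator tau,
P tau = tau + phi d tau is the representative cycle of the algorithm, and the
classes of these cycles form a basis since f maps P tau back to tau
([generator_basis]).

For the cost, a simplex with n vertices has 2^n - 1 nonempty faces, all of them
among the m simplices, hence n^2 <= 4m ([width_sqr]).  Its n faces are found by
comparing lists of at most n vertices with the m given ones, in O(m n^2), which
is O(m^2); f and phi of its boundary are sums of at most n rows of length m,
each found by a walk along the list, in O(m n); the substitution costs O(m) for
each of at most m triples.  So every simplex is processed in O(m^2), and so is
every representative cycle ([spec_algorithm]). *)

Set Implicit Arguments.
Unset Strict Implicit.
Unset Printing Implicit Defensive.

Import GRing.Theory.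
Local Open Scope ring_scope.

(** * Coefficients in the field with two elements *)

Lemma addvv (W : lmodType 'F_2) (x : W) : x + x = 0.
Proof.
rewrite -[x]scale1r -scalerDl.
by rewrite (_ : 1 + 1 = 0 :> 'F_2) ?scale0r //; apply/val_inj.
Qed.

Lemma addvK (W : lmodType 'F_2) (x y : W) : x + (x + y) = y.
Proof. by rewrite addrA addvv add0r. Qed.

Lemma F2E (a : 'F_2) : a = (a != 0)%:R.
Proof. by apply/eqP; case: a => [[|[|n]] lt_n]. Qed.

Lemma F2_add_neq0 (a b : 'F_2) : (a + b != 0) = (a != 0) (+) (b != 0).
Proof. by case: a b => [[|[|n]] la] // [[|[|p]] lb]. Qed.

Lemma F2_neq0 (a : 'F_2) : a != 0 -> a = 1.
Proof. by move=> nz_a; rewrite [a]F2E nz_a. Qed.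

Lemma F2_bool_neq0 (b : bool) : (b%:R != 0 :> 'F_2) = b.
Proof. by case: b. Qed.

(** * Contractions onto homology *)

(** A homotopy phi with d phi d = d, phi d phi = phi and phi phi = 0 contains
all the data of a contraction onto homology. *)
Section SplittingHomotopy.
Variables (C : chain_complex) (phi : homotopy_on C).

(** Under the hypotheses below this chain map, homotopic to the identity,
vanishes on boundaries and has only cycles as values: it projects all cycles
of a homology class to one representative. *)
Definition hproj q (x : C q) : C q :=
  x + (bd C q (phi q x) + homotopy_bd phi x).

Fact hproj_linear q : linear (@hproj q).
Proof.
move=> a x y; rewrite /hproj; case: q x y => [|q] x y /=.
  by rewrite !addr0 !linearP scalerDr addrACA.
rewrite !linearP !scalerDr [X in _ + X = _]addrACA.
by rewrite [LHS]addrACA.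
Qed.
HB.instance Definition _ q := GRing.isLinear.Build 'F_2 (C q) (C q) _
  (@hproj q) (@hproj_linear q).

Hypothesis bd_phi_bd : forall q (x : C q.+1),
  bd C q (phi q (bd C q x)) = bd C q x.
Hypothesis phi_bd_phi : forall q (x : C q), phi q (bd C q (phi q x)) = phi q x.
Hypothesis phi_phi : forall q (x : C q), phi q.+1 (phi q x) = 0.

Lemma bd_hproj q (x : C q.+1) : bd C q (hproj x) = 0.
Proof. by rewrite /hproj !linearD /= bdK add0r bd_phi_bd addvv. Qed.

Lemma hproj_bd q (x : C q.+1) : hproj (bd C q x) = 0.
Proof.
rewrite /hproj bd_phi_bd; case: q x => [|q] x /=; first by rewrite addr0 addvv.
by rewrite bdK linear0 addr0 addvv.
Qed.

Lemma hproj_phi q (x : C q) : hproj (phi q x) = 0.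
Proof. by rewrite /hproj phi_phi linear0 add0r /= phi_bd_phi addvv. Qed.

Lemma phi_hproj q (x : C q) : phi q (hproj x) = 0.
Proof.
rewrite /hproj !linearD /= phi_bd_phi addvK.
by case: q x => [|q] x /=; rewrite ?linear0 ?phi_phi.
Qed.

Lemma hproj_cycle q (x : C q) :
  x \in cycles C q -> hproj x = x + bd C q (phi q x).
Proof.
case: q x => [|q] x /=; first by rewrite /hproj /= addr0.
by rewrite memv_ker lfunE /hproj /= => /eqP->; rewrite linear0 addr0.
Qed.

Lemma hproj_in_cycles q (x : C q) : hproj x \in cycles C q.
Proof.
by case: q x => [|q] x /=; rewrite ?memvf // memv_ker lfunE /= bd_hproj.
Qed.

Lemma hprojK q (x : C q) : hproj (hproj x) = hproj x.
Proof.
by rewrite (hproj_cycle (hproj_in_cycles x)) phi_hproj linear0 addr0.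
Qed.

Definition hproj_cyc q (x : C q) : cycle_space C q :=
  vsproj (cycles C q) (hproj x).

Lemma hproj_cycE q (x : C q) : vsval (hproj_cyc x) = hproj x.
Proof. exact/vsprojK/hproj_in_cycles. Qed.

Fact hproj_cyc_linear q : linear (@hproj_cyc q).
Proof. by move=> a x y; rewrite /hproj_cyc !linearP. Qed.
HB.instance Definition _ q := GRing.isLinear.Build 'F_2
  (C q) (cycle_space C q) _ (@hproj_cyc q) (@hproj_cyc_linear q).

Lemma hclass_eq0 q (z : cycle_space C q) :
  hclass z = 0 -> exists w, vsval z = bd C q w.
Proof.
rewrite /hclass -(linear0 (vquot_pi (boundaries C q))) => /eqP.
rewrite vquot_piP subr0 /boundaries -memv_preim lfunE /= => /memv_imgP[w _ ->].
by exists w; rewrite lfunE.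
Qed.

Lemma hclass_bd q (z : cycle_space C q) w :
  vsval z = bd C q w -> hclass z = 0.
Proof.
move=> zE; apply/eqP; rewrite /hclass -(linear0 (vquot_pi (boundaries C q))).
rewrite vquot_piP subr0 /boundaries -memv_preim lfunE /= zE.
by apply/memv_imgP; exists w; rewrite ?memvf // lfunE.
Qed.

Lemma hclass_surj q (h : homology C q) :
  exists z : cycle_space C q, h = hclass z.
Proof.
exists (repr (h : Quotient.quot (boundaries C q))).
by rewrite /hclass vquot_piK.
Qed.

(** For a cycle z, the difference between P z and z is the boundary of phi z. *)
Lemma hclass_hproj q (z : cycle_space C q) :
  hclass (hproj_cyc (vsval z)) = hclass z.
Proof.
apply/eqP; rewrite -subr_eq0 -linearB /=; apply/eqP.
apply: (@hclass_bd _ _ (phi q (vsval z))).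
rewrite linearB /= hproj_cycE hproj_cycle ?subvsP //.
by rewrite addrC addKr.
Qed.

Definition to_homology q (x : C q) : homology C q := hclass (hproj_cyc x).

Fact to_homology_linear q : linear (@to_homology q).
Proof. by move=> a x y; rewrite /to_homology /hclass !linearP. Qed.
HB.instance Definition _ q := GRing.isLinear.Build 'F_2 (C q) (homology C q) _
  (@to_homology q) (@to_homology_linear q).

(** P of any representative; [from_homologyE] shows that the choice made by
[repr] does not matter. *)
Definition from_homology q (h : homology C q) : C q :=
  hproj (vsval (repr (h : Quotient.quot (boundaries C q)) : cycle_space C q)).

Lemma from_homologyE q (z : cycle_space C q) :
  from_homology (hclass z) = hproj (vsval z).
Proof.
rewrite /from_homology; set z' : cycle_space C q := repr _.
have: hclass (z' - z) = 0.
  by rewrite /hclass linearB /= /z' vquot_piK subrr.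
case/hclass_eq0 => w; rewrite linearB /= => /eqP; rewrite subr_eq => /eqP->.
by rewrite linearD /= hproj_bd add0r.
Qed.

Fact from_homology_linear q : linear (@from_homology q).
Proof.
move=> a h1 h2; have [[z1 ->] [z2 ->]] := (hclass_surj h1, hclass_surj h2).
by rewrite -linearP /= !from_homologyE !linearP.
Qed.
HB.instance Definition _ q := GRing.isLinear.Build 'F_2 (homology C q) (C q) _
  (@from_homology q) (@from_homology_linear q).

Definition to_hom : graded_map C (homology C) := fun q => @to_homology q.
Definition from_hom : graded_map (homology C) C := fun q => @from_homology q.

Theorem splitting_homotopy_contraction :
  is_chain_contraction to_hom from_hom phi.
Proof.
have from_to q (x : C q) : from_homology (to_homology x) = hproj x.
  by rewrite from_homologyE hproj_cycE hprojK.
split=> q.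
- move=> x; rewrite /= /to_homology (@hclass_bd _ _ 0) // hproj_cycE.
  by rewrite hproj_bd linear0.
- move=> h; have [z ->] := hclass_surj h.
  by rewrite /= from_homologyE bd_hproj linear0.
- move=> h; have [z ->] := hclass_surj h.
  rewrite /= from_homologyE /to_homology -hclass_hproj hproj_cycE hprojK.
  rewrite -hproj_cycE.
  by rewrite !hclass_hproj.
- by move=> x; rewrite /= from_to /hproj addvK.
- move=> x; rewrite /= /to_homology (@hclass_bd _ _ 0) // hproj_cycE.
  by rewrite hproj_phi linear0.
- move=> h; have [z ->] := hclass_surj h.
  by rewrite /= from_homologyE phi_hproj.
- exact: phi_phi.
Qed.

End SplittingHomotopy.

(** * One step of the incremental construction *)

Section Matrices.
Variables (m : nat) (D : 'M['F_2]_m).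
Implicit Types (F Phi : 'M['F_2]_m) (x : 'rV['F_2]_m) (i : nat).

Local Notation init i := (pid_mx i : 'M['F_2]_m).

(** The state of the algorithm after i steps, with images as rows, so that
x *m F is f x.  Multiplication by [init i] restricts to the span of the first i
simplices.  With g = 1 + phi d on the generators, g f x is
x *m F + x *m F *m D *m Phi, and [pc_homotopy] makes f, g and phi a contraction
of that subcomplex; [pc_gen] identifies the image of f with the span of the
generators. *)
Record partial_contraction i F Phi : Prop := PartialContraction {
  pc_TF : forall x, x *m init i *m F = x *m F;
  pc_FT : forall x, x *m F *m init i = x *m F;
  pc_TPhi : forall x, x *m init i *m Phi = x *m Phi;
  pc_PhiT : forall x, x *m Phi *m init i = x *m Phi;
  pc_fphi : forall x, x *m Phi *m F = 0;
  pc_phif : forall x, x *m F *m Phi = 0;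
  pc_phiphi : forall x, x *m Phi *m Phi = 0;
  pc_fd : forall x, x *m init i *m D *m F = 0;
  pc_homotopy : forall x,
    x *m init i + x *m F + x *m F *m D *m Phi
    = x *m Phi *m D + x *m init i *m D *m Phi;
  pc_gen : forall j k, F j k != 0 -> row k F = delta_mx 0 k
}.

Lemma pc_gen_row i F Phi : partial_contraction i F Phi ->
  forall x k, (x *m F) 0 k != 0 -> row k F = delta_mx 0 k.
Proof.
move=> H x k; rewrite mxE.
case: (pickP (fun j => F j k != 0)) => [j Fjk _ | F0].
  by rewrite (pc_gen H Fjk).
by rewrite big1 ?eqxx // => j _; have /negbFE/eqP-> := F0 j; rewrite mulr0.
Qed.

Lemma pc_ff i F Phi : partial_contraction i F Phi ->
  forall x, x *m F *m F = x *m F.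
Proof.
move=> H x; rewrite {1}[x *m F]row_sum_delta mulmx_suml.
rewrite [RHS]row_sum_delta; apply: eq_bigr => k _; rewrite -scalemxAl -rowE.
have [-> | /(pc_gen_row H)-> //] := eqVneq ((x *m F) 0 k) 0.
by rewrite !scale0r.
Qed.

Lemma pc0 : partial_contraction 0 0 0.
Proof.
have T0 : pid_mx 0 = 0 :> 'M['F_2]_m by apply/matrixP=> i j; rewrite !mxE andbF.
split=> [x|x|x|x|x|x|x|x|x|j k]; rewrite ?T0 ?mulmx0 ?mul0mx ?mulmx0 ?addr0 //.
by rewrite mxE eqxx.
Qed.

Hypothesis D_lower : forall i j : 'I_m, D i j != 0 -> (j < i)%N.
Hypothesis DD : forall x, x *m D *m D = 0.

Lemma coordD x y k : (x + y) 0 k = x 0 k + y 0 k.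
Proof. exact: mxE. Qed.
Lemma coordZ a x k : (a *: x) 0 k = a * x 0 k.
Proof. exact: mxE. Qed.
Lemma coord0 k : (0 : 'rV['F_2]_m) 0 k = 0.
Proof. exact: mxE. Qed.

Lemma initE i x k :
  (x *m init i : 'rV['F_2]_m) 0 k = if (k < i)%N then x 0 k else 0.
Proof.
rewrite mxE (bigD1 k) //= big1 ?addr0 => [|j neq_jk].
  by rewrite mxE eqxx; case: ifP; rewrite ?mulr1 ?mulr0.
by rewrite mxE val_eqE (negPf neq_jk) mulr0.
Qed.

Lemma initK i x : x *m init i *m init i = x *m init i.
Proof. by apply/rowP=> k; rewrite !initE; case: (k < i)%N. Qed.

Lemma initS (i : 'I_m) x :
  x *m init i.+1 = x *m init i + x 0 i *: delta_mx 0 i.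
Proof.
apply/rowP=> k; rewrite coordD coordZ !initE mxE /= ltnS leq_eqVlt.
have [-> | neq_ki] := eqVneq k i; first by rewrite eqxx ltnn mulr1 add0r.
by rewrite val_eqE (negPf neq_ki) /= mulr0 addr0.
Qed.

Lemma init_delta (i : 'I_m) : delta_mx 0 i *m init i = 0 :> 'rV['F_2]_m.
Proof.
apply/rowP=> k; rewrite initE !mxE /=; case: ifP => //.
by have [-> | ] := eqVneq k i; rewrite ?ltnn.
Qed.

Lemma init_last (i : 'I_m) x : (x *m init i : 'rV['F_2]_m) 0 i = 0.
Proof. by rewrite initE ltnn. Qed.

Lemma init_boundary i x : x *m init i *m D *m init i = x *m init i *m D.
Proof.
apply/rowP=> k; rewrite initE; case: ltnP => // le_ik.
rewrite mxE big1 // => j _; rewrite initE.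
case: ifP => [lt_ji|_]; last by rewrite mul0r.
have [->|/D_lower lt_kj] := eqVneq (D j k) 0; first by rewrite mulr0.
by have := leq_trans lt_kj (leq_trans (ltnW lt_ji) le_ik); rewrite ltnn.
Qed.

Lemma init_boundary_last (i : 'I_m) :
  delta_mx 0 i *m D *m init i = delta_mx 0 i *m D :> 'rV['F_2]_m.
Proof.
apply/rowP=> k; rewrite initE -rowE mxE; case: ltnP => // le_ik.
have [//|/D_lower lt_ki] := eqVneq (D i k) 0.
by have := leq_trans lt_ki le_ik; rewrite ltnn.
Qed.

Section Step.
Variables (i : 'I_m) (F Phi : 'M['F_2]_m).
Hypothesis H : partial_contraction i F Phi.
Local Notation e := (delta_mx 0 i : 'rV['F_2]_m).

Lemma pc_eF : e *m F = 0.
Proof. by rewrite -(pc_TF H) init_delta mul0mx. Qed.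
Lemma pc_ePhi : e *m Phi = 0.
Proof. by rewrite -(pc_TPhi H) init_delta mul0mx. Qed.
Lemma pc_Fi x : (x *m F) 0 i = 0.
Proof. by rewrite -(pc_FT H) init_last. Qed.
Lemma pc_Phii x : (x *m Phi) 0 i = 0.
Proof. by rewrite -(pc_PhiT H) init_last. Qed.
Lemma pc_TDi x : (x *m init i *m D) 0 i = 0.
Proof. by rewrite -init_boundary init_last. Qed.
Lemma pc_Di : (e *m D) 0 i = 0.
Proof. by rewrite -init_boundary_last init_last. Qed.
Lemma pc_FDF x : x *m F *m D *m F = 0.
Proof. by rewrite -(pc_FT H x) (pc_fd H). Qed.

Lemma coordii : e 0 i = 1.
Proof. by rewrite mxE !eqxx. Qed.
Lemma mul_delta_ii x : x *m delta_mx i i = x 0 i *: e.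
Proof.
apply/rowP=> k; rewrite !mxE (bigD1 i) //= big1 => [|j neq_ji].
  by rewrite !mxE eqxx addr0.
by rewrite !mxE (negPf neq_ji) mulr0.
Qed.

(* Every product is kept in the form x *m A *m B ..., the composite of the
   maps applied to x, so that the identities of the state apply as rewrite
   rules to its initial segments. *)
Let step_rules := (initS, mul_delta_ii, mulmxDl, =^~ scalemxAl, mul0mx,
  coordD, coordZ, coord0,
  initK, init_delta, init_last, init_boundary, init_boundary_last,
  pc_TF H, pc_FT H, pc_TPhi H, pc_PhiT H, pc_fphi H, pc_phif H, pc_phiphi H,
  pc_fd H, pc_ff H, pc_eF, pc_ePhi, pc_Fi, pc_Phii, pc_TDi, pc_Di, pc_FDF,
  coordii,
  scaler0, scale0r, mulr0, mul0r, addr0, add0r, mulr1, DD).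

(** The homotopy identity at sigma_i itself holds because f' sigma_i = sigma_i
cancels sigma_i, while phi sigma_i = 0 and d f' sigma_i = d sigma_i. *)
Lemma pc_new_generator : e *m D *m F = 0 ->
  partial_contraction i.+1 (F + delta_mx i i) Phi.
Proof.
move=> fd0; split.
1-9: move=> x; rewrite !(mulmxDr, step_rules, fd0, scaler0).
1: by rewrite scale1r.
1-7: by [].
1: by rewrite (addrACA (x *m _)) addvv addr0 addrA (pc_homotopy H) addrA.
move=> j k; rewrite [row _ _]rowE mulmxDr mul_delta_ii.
have [-> _ | neq_ki] := eqVneq k i.
  by rewrite pc_eF add0r coordii scale1r.
rewrite !mxE (negPf neq_ki) [i == k]eq_sym (negPf neq_ki) !andbF scale0r !addr0.
by move=> Fjk; rewrite -rowE (pc_gen H Fjk).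
Qed.

Lemma mul_col_row x (j : 'I_m) (a : 'rV['F_2]_m) :
  x *m (col j F *m a) = (x *m F) 0 j *: a.
Proof.
apply/rowP=> k; rewrite mulmxA !mxE big_ord1 !mxE; congr (_ * _).
by apply: eq_bigr => l _; rewrite mxE.
Qed.

(** Everything follows from six values: f a = a and f b = 0, phi a = phi b = 0,
a_j = 1, and d b = a + phi d a, the last one being the homotopy identity at the
cycle d sigma_i.  Thus b bounds the combination of cycles a + phi d a that
stands for the relation a, which is why it is the correction of phi for the
relation a = 0. *)
Lemma pc_eliminate (j : 'I_m) (a b : 'rV['F_2]_m) :
    a = e *m D *m F -> b = e + e *m D *m Phi -> a 0 j != 0 ->
  partial_contraction i.+1 (F + col j F *m a) (Phi + col j F *m b).
Proof.
move=> aE bE /F2_neq0 aj; have dphid : b *m D = a + a *m D *m Phi.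
  have := pc_homotopy H (e *m D).
  rewrite init_boundary_last DD mul0mx addr0 bE mulmxDl -aE => <-.
  by rewrite -addrA addvK.
have bF : b *m F = 0 by rewrite bE !step_rules.
have bPhi : b *m Phi = 0 by rewrite bE !step_rules.
have bT : b *m init i = e *m D *m Phi by rewrite bE !step_rules.
have bi : b 0 i = 1 by rewrite bE !step_rules.
have aF : a *m F = a by rewrite aE !step_rules.
have aPhi : a *m Phi = 0 by rewrite aE !step_rules.
have aT : a *m init i = a by rewrite aE !step_rules.
have ai : a 0 i = 0 by rewrite aE !step_rules.
have aDF : a *m D *m F = 0 by rewrite aE !step_rules.
split.
1-9: move=> x; rewrite !(mulmxDr, mul_col_row, step_rules, aj, bF, bPhi, bT, bi,
  aF, aPhi, aT, ai, aDF, dphid, scaler0).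
1-3, 5, 7: by [].
- by rewrite -addrA -scalerDr [_ + e]addrC -bE.
- by rewrite scalerDl addvv.
- by rewrite -aE aj scale1r addvv scaler0.
- rewrite -aE aj scale1r {1}bE [e + _]addrC addvK scalerDr.
  rewrite (addrACA (x *m init i)) (addrACA (x *m init i + _)) (pc_homotopy H).
  by rewrite [RHS]addrACA -(addrA (_ *: e)) [X in _ + X]addrC.
move=> k l; rewrite [row _ _]rowE mulmxDr mul_col_row -rowE [in X in X -> _]mxE.
have -> : (col j F *m a) k l = F k j * a 0 l by rewrite mxE big_ord1 mxE.
have [-> | neq_lj] := eqVneq l j.
  by rewrite aj mulr1 F2_add_neq0 addbb.
have [-> | /(pc_gen H)/[dup] Fl -> _] := eqVneq (F k l) 0; last first.
  by rewrite mxE [j == l]eq_sym (negPf neq_lj) andbF scale0r addr0.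
have [-> | ] := eqVneq (a 0 l) 0; first by rewrite mulr0 addr0.
rewrite {1}aE => /(pc_gen_row H)-> _.
by rewrite mxE [j == l]eq_sym (negPf neq_lj) andbF scale0r addr0.
Qed.

End Step.

End Matrices.

(** * Costs and results of list programs *)

Local Close Scope ring_scope.

(** Results and costs are specified together because the cost of a step depends
on the lengths of the lists computed before it. *)
Definition spec A (p : timed A) (n : nat) (Q : A -> Prop) : Prop :=
  Q (result p) /\ cost p <= n.

Lemma spec_ret A (x : A) (Q : A -> Prop) : Q x -> spec (ret x) 0 Q.
Proof. by []. Qed.

Lemma spec_op A (x : A) (Q : A -> Prop) : Q x -> spec (op x) 1 Q.
Proof. by []. Qed.

Lemma spec_op_pos A (x : A) n (Q : A -> Prop) : Q x -> 0 < n -> spec (op x) n Q.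
Proof. by []. Qed.

Lemma spec_weaken A (p : timed A) n (Q : A -> Prop) n' (Q' : A -> Prop) :
  spec p n Q -> n <= n' -> (forall x, Q x -> Q' x) -> spec p n' Q'.
Proof.
move=> [Qp le_pn] le_nn' QQ'.
by split; [exact: QQ' | exact: leq_trans le_nn'].
Qed.

Lemma spec_le A (p : timed A) n n' (Q : A -> Prop) :
  spec p n Q -> n <= n' -> spec p n' Q.
Proof. by move=> H le_nn'; apply: spec_weaken H le_nn' _. Qed.

Lemma spec_bind A B (p : timed A) (k : A -> timed B) n1 n2
    (P : A -> Prop) (Q : B -> Prop) :
    spec p n1 P -> (forall x, P x -> spec (k x) n2 Q) ->
  spec (bind p k) (n1 + n2) Q.
Proof.
move=> [Pp le1] /(_ _ Pp)[Qk le2]; split=> //=.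
exact: leq_add.
Qed.

Lemma spec_bindE A B (p : timed A) (k : A -> timed B) n1 n2 x (Q : B -> Prop) :
  spec p n1 (eq x) -> spec (k x) n2 Q -> spec (bind p k) (n1 + n2) Q.
Proof. by move=> Hp Hk; apply: spec_bind Hp _ => _ <-. Qed.

Lemma spec_charge A (p : timed A) n (Q : A -> Prop) :
  spec p n Q -> spec (charge p) n.+1 Q.
Proof. by move=> Hp; apply: (@spec_bind _ _ _ _ 1 _ xpredT). Qed.

Section Loops.
Variables A B : Type.

Lemma spec_mapT I (t : I -> A) (h : A -> timed B) (g : I -> B) c ks :
  (forall k, spec (h (t k)) c (eq (g k))) ->
  spec (mapT h (map t ks)) (size ks * c.+1 + 1) (eq (map g ks)).
Proof.
move=> hg; elim: ks => [|k ks IHks] /=; first exact: spec_op.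
apply: spec_le.
  by apply: (spec_bindE (hg k)); apply: (spec_bindE IHks); apply: spec_op.
by rewrite mulSn; lia.
Qed.

Lemma spec_foldT (h : A -> B -> timed B) (I : seq A -> B -> Prop) c acc s :
    I [::] acc ->
    (forall s1 x s2 acc, s = s1 ++ x :: s2 -> I s1 acc ->
       spec (h x acc) c (I (rcons s1 x))) ->
  spec (foldT h acc s) (size s * c.+1 + 1) (I s).
Proof.
move=> I0 hI; suff gen s2 s1 acc' : I s1 acc' -> s = s1 ++ s2 ->
    spec (foldT h acc' s2) (size s2 * c.+1 + 1) (I s) by exact: gen I0 _.
elim: s2 s1 acc' => [|x s2 IHs] s1 acc' Is1 def_s.
  by apply: spec_op; rewrite def_s cats0.
apply: spec_le => /=.
  apply: spec_charge; apply: spec_bind (hI _ _ _ _ def_s Is1) _ => acc2 Iacc2.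
  by apply: IHs Iacc2 _; rewrite cat_rcons.
by rewrite mulSn; lia.
Qed.

Lemma spec_filterT (p : A -> timed bool) (a : pred A) c s :
  (forall x, spec (p x) c (eq (a x))) ->
  spec (filterT p s) (size s * c.+1 + 1) (eq (filter a s)).
Proof.
move=> pa; elim: s => [|x s IHs] /=; first exact: spec_op.
apply: spec_le.
  apply: (spec_bindE (pa x)); apply: (spec_bindE IHs); exact: spec_op.
by rewrite mulSn; lia.
Qed.

Lemma spec_numberT i (s : seq A) :
  spec (numberT i s) (size s * 2 + 1) (eq (zip (iota i (size s)) s)).
Proof.
elim: s i => [|x s IHs] i /=; first exact: spec_op.
apply: spec_le.
  apply: spec_bindE (spec_op _) _ => //.
  by apply: (spec_bindE (IHs _)); apply: spec_op.
by lia.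
Qed.

Lemma spec_fold_ord n (t : 'I_n -> A) (h : A -> B -> timed B)
    (I : nat -> B -> Prop) c acc :
    I 0 acc ->
    (forall (k : 'I_n) acc', I k acc' -> spec (h (t k) acc') c (I k.+1)) ->
  spec (foldT h acc [seq t k | k <- enum 'I_n]) (n * c.+1 + 1) (I n).
Proof.
move=> I0 hI; set r := map _ _.
have szr : size r = n by rewrite size_map size_enum_ord.
have := @spec_foldT h (fun r1 acc' => I (size r1) acc') c acc r I0; rewrite szr.
apply=> r1 x r2 acc' def_r Ir1.
have lt_r1n : size r1 < n by rewrite -szr def_r size_cat /= -addSnnS leq_addr.
have -> : x = t (Ordinal lt_r1n).
  have -> : x = nth x r (size r1) by rewrite def_r nth_cat ltnn subnn.
  rewrite (nth_map (Ordinal lt_r1n)) ?size_enum_ord //; congr (t _).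
  by apply: val_inj; rewrite /= nth_enum_ord.
by rewrite size_rcons; apply: (hI (Ordinal lt_r1n)).
Qed.

End Loops.

Lemma spec_seq_eqT (T : eqType) (s t : seq T) :
  spec (seq_eqT s t) (size s * 2 + 1) (eq (s == t)).
Proof.
elim: s t => [|x s IHs] [|y t] /=; try exact: spec_op.
apply: spec_le.
  apply: (@spec_bindE _ _ _ _ 1 (size s * 2 + 2) (x == y)).
    exact: spec_op.
  rewrite eqseq_cons; case: (x == y) => //=.
  by apply: spec_le (spec_charge (IHs t)) _; lia.
by lia.
Qed.

Lemma spec_addT u v : size u = size v ->
  spec (addT u v) (size u * 2 + 1)
    (fun w => size w = size u /\
       forall k, nth false w k = nth false u k (+) nth false v k).
Proof.
elim: u v => [|a u IHu] [|b v] //= => [_ | [eq_uv]].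
  by apply: spec_op; split=> // k; rewrite nth_nil.
apply: spec_le.
  apply: spec_bindE (spec_op _) _ => //.
  apply: spec_bind (IHu v eq_uv) _ => w [szw wE].
  by apply: spec_op; split=> [|[|k]] //=; rewrite ?szw ?wE.
by lia.
Qed.

Lemma spec_coefT u j : spec (coefT u j) (size u + 1) (eq (nth false u j)).
Proof.
elim: u j => [|a u IHu] [|j] /=; try exact: spec_op.
exact: spec_charge.
Qed.

Lemma spec_clearT u j :
  spec (clearT u j) (size u + 1)
    (fun w => size w = size u /\
       forall k, nth false w k = (k != j) && nth false u k).
Proof.
elim: u j => [|a u IHu] [|j] /=.
- by apply: spec_op; split=> // k; rewrite nth_nil andbF.
- by apply: spec_op; split=> // k; rewrite nth_nil andbF.
- by apply: spec_op_pos; rewrite ?addn1 //; split=> // -[|k].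
apply: spec_le.
  apply: spec_bind (IHu j) _ => w [szw wE]; apply: spec_op.
  by split=> [|[|k]] //=; rewrite ?szw ?wE.
by lia.
Qed.

Lemma spec_supportT i u :
  spec (supportT i u) (size u * 2 + 1)
    (fun js => forall j, (j \in js) = (i <= j) && nth false u (j - i)).
Proof.
elim: u i => [|a u IHu] i /=.
  by apply: spec_op => j; rewrite nth_nil andbF.
apply: spec_le.
  apply: spec_bindE (spec_op _) _ => //; apply: spec_bind (IHu _) _ => js jsE.
  apply: spec_op => j; have [-> | neq_ij] := eqVneq j i.
    rewrite leqnn subnn /=; case: a; first by rewrite inE eqxx.
    by rewrite jsE ltnn.
  have -> : (j \in (if a then i :: js else js)) = (j \in js).
    by case: a; rewrite // inE (negPf neq_ij).
  rewrite jsE ltn_neqAle eq_sym neq_ij /=; case: leqP => //= le_ij.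
  by rewrite subnS -[j - i]prednK // subn_gt0 ltn_neqAle eq_sym neq_ij.
by lia.
Qed.

(** * Chains as lists of bits *)

Section Rows.
Variable m : nat.
Local Open Scope ring_scope.
Implicit Types u v : 'rV['F_2]_m.

(** The list that represents a row vector in the algorithm.  Stating the results
of list programs as values of [bits] keeps track of all lengths. *)
Definition bits u : bitseq := [seq u 0 k != 0 | k <- enum 'I_m].

Lemma size_bits u : size (bits u) = m.
Proof. by rewrite size_map size_enum_ord. Qed.

Lemma nth_bits u (k : 'I_m) : nth false (bits u) k = (u 0 k != 0).
Proof. by rewrite (nth_map k) ?size_enum_ord // nth_ord_enum. Qed.

Lemma bitsP u w :
  size w = m -> (forall k : 'I_m, nth false w k = (u 0 k != 0)) -> bits u = w.
Proof.
move=> szw wE; apply: (@eq_from_nth _ false) => [|k]; rewrite size_bits ?szw //.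
by move=> lt_km; rewrite -[k]/(nat_of_ord (Ordinal lt_km)) nth_bits wE.
Qed.

Lemma bits_inj : injective bits.
Proof.
move=> u v eq_uv; apply/rowP=> k.
by rewrite [u 0 k]F2E [v 0 k]F2E -!nth_bits eq_uv.
Qed.

Lemma spec_add_bits u v :
  spec (addT (bits u) (bits v)) (m * 2 + 1) (eq (bits (u + v))).
Proof.
have := @spec_addT (bits u) (bits v); rewrite !size_bits => /(_ erefl) H.
apply: spec_weaken H _ _ => // w [szw wE]; apply: bitsP => // k.
by rewrite wE !nth_bits mxE F2_add_neq0.
Qed.

Lemma spec_clear_bits u (j : 'I_m) : u 0 j != 0 ->
  spec (clearT (bits u) j) (m + 1) (eq (bits (u + delta_mx 0 j))).
Proof.
move=> /F2_neq0 uj; have := @spec_clearT (bits u) j; rewrite size_bits => H.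
apply: spec_weaken H _ _ => // w [szw wE]; apply: bitsP => // k.
rewrite wE nth_bits !mxE F2_add_neq0 /= val_eqE.
have [-> | _] := eqVneq k j; first by rewrite uj.
by rewrite addbF.
Qed.

Lemma spec_support_bits u :
  spec (supportT 0 (bits u)) (m * 2 + 1)
    (fun js => (forall j, j \in js -> exists2 k : 'I_m, j = k & u 0 k != 0) /\
               (js = [::] -> u = 0)).
Proof.
have := spec_supportT 0 (bits u); rewrite size_bits => H.
apply: spec_weaken H _ _ => // js jsE; split=> [j | js0].
  rewrite jsE subn0 /= => uj; have lt_jm: (j < m)%N.
    by rewrite -(size_bits u) ltnNge; apply: contraTN uj => /(nth_default _)->.
  by exists (Ordinal lt_jm); rewrite // -nth_bits.
apply/rowP=> k; apply/eqP; rewrite mxE -[_ == _]negbK -nth_bits.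
by have := jsE k; rewrite js0 subn0 /= => <-.
Qed.

Lemma spec_eq_bits u v :
  spec (seq_eqT (bits u) (bits v)) (m * 2 + 1) (eq (u == v)).
Proof.
have := spec_seq_eqT (bits u) (bits v).
by rewrite size_bits (inj_eq bits_inj).
Qed.

Section Input.
Variables (V : eqType) (verts_of : 'I_m -> seq V).

Definition numbered : seq (nat * seq V) :=
  [seq (val k, verts_of k) | k <- enum 'I_m].

Lemma size_numbered : size numbered = m.
Proof. by rewrite size_map size_enum_ord. Qed.

Lemma spec_zeroT : spec (zeroT numbered) (m * 2 + 1) (eq (bits 0)).
Proof.
rewrite -[X in (X * 2)%N](size_enum_ord m); apply: spec_mapT => k.
by apply: spec_op; rewrite mxE eqxx.
Qed.

Lemma spec_unitT (i : 'I_m) :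
  spec (unitT numbered i) (m * 2 + 1) (eq (bits (delta_mx 0 i))).
Proof.
rewrite -[X in (X * 2)%N](size_enum_ord m); apply: spec_mapT => k.
by apply: spec_op; rewrite mxE F2_bool_neq0 eqxx.
Qed.

End Input.

Definition encode (ks : seq 'I_m) (F P G : 'M['F_2]_m) : seq triple :=
  [seq Triple (val k) (bits (row k F)) (bits (row k P)) (bits (row k G))
     | k <- ks].

Lemma spec_lookup (ks : seq 'I_m) (F P G : 'M['F_2]_m) (k : 'I_m) :
  spec (lookupT k (encode ks F P G)) (size ks * 2 + 1)
    (eq (if k \in ks then
           Some (Triple k (bits (row k F)) (bits (row k P)) (bits (row k G)))
         else None)).
Proof.
elim: ks => [|k' ks IHks] /=; first exact: spec_op.
apply: spec_le.
  apply: (@spec_bindE _ _ _ _ 1 (size ks * 2 + 2) (k' == k)).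
    exact: spec_op.
  rewrite inE eq_sym; case: eqP => [-> | _] /=; first exact: spec_ret.
  by apply: spec_le (spec_charge IHks) _; lia.
by lia.
Qed.

Definition chain_sum (ks : seq 'I_m) : 'rV['F_2]_m :=
  \sum_(k <- ks) delta_mx 0 k.

(** Simplices without a triple contribute nothing, in accordance with the rows
outside ks being zero. *)
Lemma spec_evalT (V : eqType) (verts_of : 'I_m -> seq V) (ks : seq 'I_m)
    (F P G : 'M['F_2]_m) (b : seq 'I_m) :
    (size ks <= m)%N ->
    (forall k : 'I_m, k \notin ks ->
       [/\ row k F = 0, row k P = 0 & row k G = 0]) ->
  spec (evalT (numbered verts_of) (encode ks F P G) (map val b))
    (m * 2 + 1 + (size b * (m * 8 + 5).+1 + 1))
    (eq (bits (chain_sum b *m F), bits (chain_sum b *m P),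
         bits (chain_sum b *m G))).
Proof.
move=> szks out; apply: (spec_bindE (spec_zeroT _)).
rewrite -(size_map val b).
pose I ts acc := exists2 c : seq 'I_m, ts = map val c &
  acc = (bits (chain_sum c *m F), bits (chain_sum c *m P),
         bits (chain_sum c *m G)).
apply: spec_weaken (@spec_foldT _ _ _ I (m * 8 + 5)%N _ _ _ _) _ _ => //.
- by exists [::]; rewrite // /chain_sum big_nil !mul0mx.
- move=> s1 t s2 acc def_b [c -> ->].
  have [k -> ] : exists k : 'I_m, t = k.
    have : t \in map val b by rewrite def_b mem_cat inE eqxx orbT.
    by case/mapP => k _ ->; exists k.
  have chain_rcons M : chain_sum (rcons c k) *m M = chain_sum c *m M + row k M.
    by rewrite /chain_sum big_rcons /= mulmxDl -rowE addrC.
  apply: spec_le.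
    apply: (spec_bindE (spec_lookup _ _ _ _ _)).
    instantiate (1 := (3 * (m * 2 + 1) + 1)%N).
    case: ifPn => [_ | /out[F0 P0 G0]] /=; last first.
      apply: (@spec_le _ _ 0) => //; apply: spec_ret.
      by exists (rcons c k); rewrite ?map_rcons // !chain_rcons F0 P0 G0 !addr0.
    apply: spec_le.
      apply: (spec_bindE (spec_add_bits _ _)).
      apply: (spec_bindE (spec_add_bits _ _)).
      apply: (spec_bindE (spec_add_bits _ _)); apply: spec_op.
      by exists (rcons c k); rewrite ?map_rcons // !chain_rcons.
    by lia.
  by lia.
by move=> acc [c /(inj_map val_inj)-> ->].
Qed.

(** The symbolic part of the triple equals its second part, and stays equal to
it.  The generator sigma_j is cleared and replaced by a + sigma_j; its two
copies cancel, so that substituting amounts to adding a. *)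
Lemma spec_substT t u p a b (j : 'I_m) :
  let sol := bits (a + delta_mx 0 j) in
  spec (substT j sol (bits b) sol (Triple t (bits u) (bits p) (bits u)))
    (m * 10 + 8)
    (eq (Triple t (bits (u + u 0 j *: a)) (bits (p + u 0 j *: b))
                  (bits (u + u 0 j *: a)))).
Proof.
have coefj v : spec (coefT (bits v) j) (m + 1) (eq (v 0 j != 0)).
  by have := spec_coefT (bits v) j; rewrite size_bits nth_bits.
have uE : u 0 j != 0 -> u + delta_mx 0 j + (a + delta_mx 0 j) = u + a.
  by move=> _; rewrite [a + _]addrC addrA -(addrA u) addvv addr0.
apply: spec_le.
  apply: (spec_bindE (coefj u)).
  apply: (@spec_bindE _ _ _ _ (3 * m + 2) _ (bits (u + u 0 j *: a))).
    case: ifP => [uj | /negbFE/eqP->]; last by rewrite scale0r addr0.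
    apply: spec_le.
      apply: (spec_bindE (spec_clear_bits uj)).
      rewrite (F2_neq0 uj) scale1r -uE //; exact: spec_add_bits.
    by lia.
  apply: (spec_bindE (coefj u)).
  instantiate (1 := (5 * m + 4)%N).
  case: ifP => [uj | /negbFE/eqP->]; last first.
    by rewrite !scale0r !addr0; apply: spec_op_pos; rewrite // addn_gt0 orbT.
  apply: spec_le.
    apply: (spec_bindE (spec_add_bits _ _)).
    apply: (spec_bindE (spec_clear_bits uj)).
    apply: (spec_bindE (spec_add_bits _ _)).
    by rewrite uE // (F2_neq0 uj) !scale1r; apply: spec_op.
  by lia.
by lia.
Qed.

End Rows.

Local Open Scope ring_scope.

(** * The chains of all dimensions as row vectors *)

Section Indexed.
Variables (V : finType) (K : simplicial_complex V) (s : seq {set V}).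
Hypothesis sorted_s : sorted_simplices K s.
Local Notation m := (size s).

Definition nth_simplex (k : 'I_m) : {set V} := nth set0 s k.
Local Notation S := nth_simplex.

Lemma simplices_uniq : uniq s. Proof. by case: sorted_s. Qed.
Lemma simplices_mem : s =i simplices K. Proof. by case: sorted_s. Qed.

Lemma nth_simplexK k : index (S k) s = k.
Proof. by rewrite index_uniq ?simplices_uniq. Qed.

Lemma nth_simplex_inj : injective S.
Proof.
move=> k l eq_kl; apply/val_inj.
by rewrite /= -nth_simplexK eq_kl nth_simplexK.
Qed.

Lemma nth_simplex_in k : S k \in simplices K.
Proof. by rewrite -simplices_mem mem_nth. Qed.

Lemma simplices_neq0 t : t \in simplices K -> t != set0.
Proof. by apply: contraTneq => ->; case: (simplicesP K). Qed.

Lemma card_simplex_gt0 k : (0 < #|S k|)%N.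
Proof. by rewrite card_gt0 simplices_neq0 ?nth_simplex_in. Qed.

Lemma map_nth_simplex : [seq S k | k <- enum 'I_m] = s.
Proof.
rewrite /S (map_comp (nth set0 s) val) val_enum_ord.
exact: mkseq_nth.
Qed.

Definition boundary_mx : 'M['F_2]_m :=
  \matrix_(i, k) \sum_(v in S i) (S k == S i :\ v)%:R.
Local Notation D := boundary_mx.

Lemma boundary_mx_neq0 i k :
  D i k != 0 -> exists2 v, v \in S i & S k = S i :\ v.
Proof.
rewrite mxE => nzD.
case: (pickP [pred v | (v \in S i) && (S k == S i :\ v)]) => [v|nov].
  case/andP=> Sv /eqP Sk.
  by exists v.
case/eqP: nzD; rewrite big1 // => v Sv.
by have := nov v; rewrite /= Sv /= => ->.
Qed.

(** This is where the order matters: a face of a simplex lies in the same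
initial segment and is a different simplex, so it comes earlier. *)
Lemma boundary_mx_lower i k : D i k != 0 -> (k < i)%N.
Proof.
case/boundary_mx_neq0 => v Sv Sk.
have [_ _ /(_ i.+1 (ltn_ord i))[_ sub_i]] := sorted_s.
have take_i : S i \in take i.+1 s.
  by rewrite /S -(nth_take _ (ltnSn i)) mem_nth // size_takel.
have := sub_i (S i) (S k).
rewrite !inE take_i Sk subD1set -Sk => /(_ erefl erefl).
rewrite simplices_neq0 ?nth_simplex_in // => /(_ erefl).
rewrite in_take_leq // nth_simplexK ltnS leq_eqVlt.
case/orP=> [/eqP/val_inj eq_ki | //].
by move: Sv; rewrite -eq_ki in Sk *; rewrite Sk !inE eqxx.
Qed.

(** Chains are graded by the number of vertices, one more than the dimension. *)
Definition homog n (x : 'rV['F_2]_m) : bool :=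
  [forall k, (x 0 k != 0) ==> (#|S k| == n)].

Lemma homogP n (x : 'rV['F_2]_m) :
  reflect (forall k, x 0 k != 0 -> #|S k| = n) (homog n x).
Proof. by apply: (iffP 'forall_implyP) => hx k /hx/eqP. Qed.

Lemma homogD n (x y : 'rV['F_2]_m) : homog n x -> homog n y -> homog n (x + y).
Proof.
move=> /homogP hx /homogP hy; apply/homogP=> k; rewrite mxE.
have [-> | /hx//] := eqVneq (x 0 k) 0.
by rewrite add0r => /hy.
Qed.

Lemma homogZ n a (x : 'rV['F_2]_m) : (a != 0 -> homog n x) -> homog n (a *: x).
Proof.
move=> hx; apply/homogP=> k; rewrite mxE mulf_eq0 negb_or => /andP[/hx/homogP].
exact.
Qed.

Lemma homog_delta k : homog #|S k| (delta_mx 0 k).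
Proof. by apply/homogP=> l; rewrite mxE eqxx /= F2_bool_neq0 => /eqP->. Qed.

Lemma homog_mul (h : nat -> nat) (M : 'M['F_2]_m) n x :
  (forall i, homog (h #|S i|) (row i M)) -> homog n x -> homog (h n) (x *m M).
Proof.
move=> hM /homogP hx; apply/homogP=> k; rewrite mxE => nz.
suff [i] : exists i, x 0 i * M i k != 0.
  rewrite mulf_eq0 negb_or => /andP[/hx <- Mik].
  by apply: (homogP _ _ (hM i)); rewrite mxE.
case: (pickP (fun i => x 0 i * M i k != 0)) => [i nzi | z]; first by exists i.
by case/eqP: nz; rewrite big1 // => i _; have /negbFE/eqP := z i.
Qed.

Lemma homog_boundary i : homog #|S i|.-1 (row i D).
Proof.
apply/homogP=> k; rewrite mxE => /boundary_mx_neq0[v Sv ->].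
by rewrite [#|S i|](cardsD1 v) Sv.
Qed.

Section Embedding.
Variable q : nat.

Lemma simplex_index_lt (x : simplex K q) : (index (verts x) s < m)%N.
Proof. by rewrite index_mem simplices_mem; case/andP: (valP x). Qed.

Definition simplex_index (x : simplex K q) : 'I_m :=
  Ordinal (simplex_index_lt x).

Lemma simplex_indexK x : S (simplex_index x) = verts x.
Proof. by rewrite /S nth_index // simplices_mem; case/andP: (valP x). Qed.

Lemma simplex_index_inj : injective simplex_index.
Proof.
move=> x y eq_xy; apply: val_inj.
by rewrite -[val x]simplex_indexK eq_xy simplex_indexK.
Qed.

Lemma card_simplex_index x : #|S (simplex_index x)| = q.+1.
Proof. by rewrite simplex_indexK; case/andP: (valP x) => _ /eqP. Qed.

Lemma simplex_of k : #|S k| = q.+1 -> exists x, k = simplex_index x.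
Proof.
move=> Sk; have Kk : (S k \in simplices K) && (#|S k| == q.+1).
  by rewrite nth_simplex_in Sk eqxx.
pose P (t : {set V}) := (t \in simplices K) && (#|t| == q.+1).
exists (@exist _ P _ Kk : simplex K q); apply: nth_simplex_inj.
by rewrite simplex_indexK.
Qed.

Definition emb (c : schain K q) : 'rV['F_2]_m :=
  \row_k oapp (coefficient c) 0 (insub (S k) : option (simplex K q)).

Lemma embE c x : emb c 0 (simplex_index x) = coefficient c x.
Proof. by rewrite mxE simplex_indexK /verts valK. Qed.

Lemma homog_emb c : homog q.+1 (emb c).
Proof.
apply/homogP=> k; rewrite mxE; by case: insubP => [x /andP[_ /eqP] |].
Qed.

Lemma homog_eq x y : homog q.+1 x -> homog q.+1 y ->
    (forall t : simplex K q, x 0 (simplex_index t) = y 0 (simplex_index t)) ->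
  x = y.
Proof.
move=> /homogP hx /homogP hy eq_xy; apply/rowP=> k.
have [/simplex_of[t ->] //|/eqP Sk] := eqVneq #|S k| q.+1.
have [->|/hx//] := eqVneq (x 0 k) 0; symmetry.
by have [//|/hy//] := eqVneq (y 0 k) 0.
Qed.

Lemma bits_emb c : chain_bits s c = bits (emb c).
Proof.
rewrite /chain_bits -{1}map_nth_simplex -map_comp; apply: eq_map => k /=.
by rewrite mxE.
Qed.

Fact emb_linear : linear emb.
Proof.
move=> a c d; apply/rowP=> k; rewrite !mxE; case: insub => [x|] /=.
  by rewrite /coefficient !ffunE.
by rewrite mulr0 addr0.
Qed.
HB.instance Definition _ := GRing.isLinear.Build 'F_2 (schain K q) 'rV['F_2]_m _
  emb emb_linear.

Definition prj (x : 'rV['F_2]_m) : schain K q :=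
  [ffun t => x 0 (simplex_index t)].

Fact prj_linear : linear prj.
Proof. by move=> a c d; apply/ffunP=> x; rewrite !ffunE !mxE. Qed.
HB.instance Definition _ := GRing.isLinear.Build 'F_2 'rV['F_2]_m (schain K q) _
  prj prj_linear.

Lemma embK : cancel emb prj.
Proof. by move=> c; apply/ffunP=> x; rewrite ffunE embE. Qed.

Lemma prjK x : homog q.+1 x -> emb (prj x) = x.
Proof.
move=> hx; apply: homog_eq (homog_emb _) hx _ => t.
by rewrite embE /coefficient ffunE.
Qed.

Lemma emb_basis x : emb (basis_chain x) = delta_mx 0 (simplex_index x).
Proof.
apply: homog_eq (homog_emb _) _ _ => [|t].
  by rewrite -(card_simplex_index x); apply: homog_delta.
by rewrite embE /coefficient ffunE mxE eqxx (inj_eq simplex_index_inj).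
Qed.

Lemma schain_sum (c : schain K q) : c = \sum_x coefficient c x *: basis_chain x.
Proof.
apply/ffunP=> y; rewrite sum_ffunE (bigD1 y) //= big1 => [|x neq_xy].
  by rewrite !ffunE eqxx addr0 /coefficient [_ *: _]mulr1.
by rewrite !ffunE eq_sym (negPf neq_xy) scaler0.
Qed.

End Embedding.

Lemma emb_simplex_bd q (x : simplex K q.+1) :
  emb (simplex_bd x) = row (simplex_index x) D.
Proof.
apply: homog_eq (homog_emb _) _ _ => [|t].
  have := @homog_boundary (simplex_index x); rewrite card_simplex_index.
  exact.
by rewrite embE /coefficient ffunE !mxE !simplex_indexK.
Qed.

Lemma emb_bd q (c : schain K q.+1) : emb (chain_bd c) = emb c *m D.
Proof.
rewrite [in RHS](schain_sum c) !linear_sum mulmx_suml; apply: eq_bigr => x _.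
by rewrite !linearZ /= -scalemxAl emb_basis -rowE emb_simplex_bd.
Qed.

(** A face of a vertex would be the empty set, which is not a simplex,
in accordance with the zero differential on C_0. *)
Lemma homog1_boundary (x : 'rV['F_2]_m) : homog 1 x -> x *m D = 0.
Proof.
move=> hx; have /homogP h0 := homog_mul homog_boundary hx.
apply/rowP=> k; rewrite [RHS]mxE; apply/eqP; apply: contraT => nz.
have Sk := h0 k nz; by have := card_simplex_gt0 k; rewrite Sk.
Qed.

Lemma boundary_boundary (x : 'rV['F_2]_m) : x *m D *m D = 0.
Proof.
rewrite [x]row_sum_delta !mulmx_suml big1 // => k _.
rewrite -!scalemxAl; have := card_simplex_gt0 k; case Sk: #|S k| => [//|q] _.
have [t ->] := simplex_of Sk; rewrite -emb_basis.
case: q t {Sk} => [|[|q]] t.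
- by rewrite (homog1_boundary (homog_emb _)) mul0mx scaler0.
- by rewrite -emb_bd (homog1_boundary (homog_emb _)) scaler0.
by rewrite -!emb_bd chain_bdK linear0 scaler0.
Qed.

End Indexed.
Arguments emb {V K s q} c.

(** * The run of the algorithm *)

Lemma enum_set_inj (V : finType) : injective (fun A : {set V} => enum A).
Proof. by move=> A B eq_AB; rewrite -[A]set_enum eq_AB set_enum. Qed.

(** The factor 2 is needed at n = 3. *)
Lemma sqr_le_expn n : (n * n <= 2 * 2 ^ n)%N.
Proof.
elim: n => // -[|[|[|n]]] IHn //; rewrite expnS; nia.
Qed.

Section Run.
Variables (V : finType) (K : simplicial_complex V) (s : seq {set V}).
Hypothesis sorted_s : sorted_simplices K s.
Local Notation m := (size s).
Local Notation S := (@nth_simplex V s).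
Local Notation D := (boundary_mx s).

Definition input := numbered (fun k : 'I_m => enum (S k)).

Lemma numberT_input : zip (iota 0 m) (simplex_lists s) = input.
Proof.
rewrite /simplex_lists -{2}(map_nth_simplex s) -val_enum_ord -map_comp.
by rewrite /input /numbered; elim: (enum _) => //= k ks ->.
Qed.

Definition width : nat := \max_(k < m) #|S k|.

Lemma card_le_width k : (#|S k| <= width)%N.
Proof. exact: leq_bigmax. Qed.

Lemma card_simplices : #|simplices K| = m.
Proof.
rewrite -(eq_card (simplices_mem sorted_s)).
exact/card_uniqP/simplices_uniq/sorted_s.
Qed.

Lemma expn_card_simplex k : (2 ^ #|S k| <= m.+1)%N.
Proof.
rewrite -card_powerset -card_simplices (cardsD1 set0) powersetE sub0set ltnS.
apply/subset_leq_card/subsetP=> t; rewrite !inE => /andP[t0 sub_t].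
by apply: (simplicesP K).2 sub_t t0; apply: nth_simplex_in.
Qed.

(** All nonempty faces of a simplex are among the m simplices, so the number of
its vertices is at most logarithmic in m; a weak consequence suffices. *)
Lemma width_sqr : (width * width <= 4 * m)%N.
Proof.
rewrite /width; case: (pickP 'I_m) => [k0 _ | no_k]; last first.
  by rewrite big1 // => k; have := no_k k.
have [k ->] : {k | \max_(k < m) #|S k| = #|S k|}%N.
  by apply: eq_bigmax; apply/card_gt0P; exists k0.
have := sqr_le_expn #|S k|; have := expn_card_simplex k.
have := ltn_ord k0. set e := (2 ^ _)%N. lia.
Qed.

Lemma width_le : (width <= 4 * m)%N.
Proof.
by apply: leq_trans width_sqr; case: width => // w; rewrite leq_pmulr.
Qed.

Lemma spec_faceT (A : {set V}) v :
  spec (faceT (enum A) v) (#|A| * 2 + 1) (eq (enum (A :\ v))).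
Proof.
rewrite cardE.
have := @spec_filterT _ (fun w => op (w != v)) (predC1 v) 1 (enum A).
move=> /(_ (fun=> spec_op erefl)) H; apply: spec_weaken H _ _ => // _ <-.
rewrite /enum_mem -filter_predI; apply: eq_filter => w /=.
by rewrite !inE.
Qed.

(** With w^2 <= 4m and w <= 4m for the width w, this bounds
w (2w + 3) (m + 1) + 1, the cost of comparing w faces with m simplices. *)
Definition boundary_cost := (20 * (m * m) + 20 * m + 1)%N.

(** Each face is found at most once, since no simplex is listed twice; hence the
boundary has at most as many terms as the simplex has vertices.  This count
enters the cost of evaluating f and phi on the boundary. *)
Lemma spec_boundaryT (i : 'I_m) :
  spec (boundaryT input (enum (S i))) boundary_cost
    (fun b => exists ks : seq 'I_m, [/\ b = map val ks,
       (size ks <= width)%N & chain_sum ks = row i D]).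
Proof.
pose faces v := [seq k <- enum 'I_m | S k == S i :\ v].
pose I (vs : seq V) (b : seq nat) := exists ks : seq 'I_m, [/\ b = map val ks,
  (size ks <= size vs)%N & chain_sum ks =
    \sum_(v <- vs) \row_k (S k == S i :\ v)%:R].
have le_n := card_le_width i.
pose c := (width * 2 + 1 + (m * (width * 2 + 3) + 1))%N.
apply: spec_weaken (@spec_foldT _ _ _ I c _ _ _ _) _ _.
- by exists [::]; split; rewrite // /chain_sum !big_nil.
- move=> vs v vs' acc _ [ks [-> le_ks sum_ks]].
  apply: spec_bindE.
    by apply: spec_le (spec_faceT _ _) _; lia.
  pose J (ps : seq (nat * seq V)) (b : seq nat) :=
    b = rev [seq p.1 | p <- ps & p.2 == enum (S i :\ v)] ++ map val ks.
  apply: spec_weaken (@spec_foldT _ _ _ J (width * 2 + 2)%N _ _ _ _) _ _ => //.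
  + move=> ps p ps' acc' _ ->; apply: spec_le.
      apply: spec_bindE.
        apply: spec_le (spec_seq_eqT _ _) _.
        instantiate (1 := (width * 2 + 1)%N); rewrite -cardE.
        by have := subset_leq_card (subD1set (S i) v); lia.
      instantiate (1 := 1%N).
      rewrite /J filter_rcons [p.2 == _]eq_sym; case: eqP => _.
        by apply: spec_op; rewrite map_rcons rev_rcons.
      by apply: spec_le (spec_ret _) _.
    by lia.
  + by rewrite size_numbered; lia.
  move=> b ->; exists (rev (faces v) ++ ks).
  rewrite /input /numbered filter_map -map_comp map_cat map_rev.
  rewrite size_cat size_rev.
  have -> : [seq x <- enum 'I_m | preim (fun k : 'I_m => (val k, enum (S k)))
      (fun p => p.2 == enum (S i :\ v)) x] = faces v.
    by apply: eq_filter => k /=; rewrite (inj_eq (@enum_set_inj V)).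
  split=> //.
    rewrite size_rcons -add1n leq_add //.
    have -> : faces v = enum [pred k : 'I_m | S k == S i :\ v].
      by rewrite [in RHS]/enum_mem -enumT.
    rewrite -cardE; apply/card_le1_eqP=> k l; rewrite !inE => /eqP Sk /eqP Sl.
    by apply: (nth_simplex_inj sorted_s); rewrite Sk Sl.
  rewrite /chain_sum big_cat big_rcons /= -[X in _ + X]/(chain_sum ks) sum_ks.
  rewrite addrC.
  congr (_ + _); rewrite (perm_big _ (permEl (perm_rev _))) big_filter /=.
  rewrite big_enum_cond /=.
  rewrite [RHS]row_sum_delta big_mkcond; apply: eq_bigr => k _; rewrite mxE.
  by case: eqP; rewrite ?scale1r ?scale0r.
- rewrite -cardE /c /boundary_cost; set n := #|S i| in le_n *.
  have := width_sqr; have := width_le; move: width le_n => w le_nw le_wm le_wwm.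
  have : (n * (w * 2 + 1 + (m * (w * 2 + 3) + 1)).+1
           <= w * (w * 2 + 1 + (m * (w * 2 + 3) + 1)).+1)%N.
    by rewrite leq_mul2r le_nw orbT.
  have -> : (w * (w * 2 + 1 + (m * (w * 2 + 3) + 1)).+1
    = 2 * (w * w) + 3 * w + m * (2 * (w * w)) + m * (3 * w))%N by lia.
  have : (m * (w * w) <= m * (4 * m))%N by rewrite leq_mul2l le_wwm orbT.
  have : (m * w <= m * (4 * m))%N by rewrite leq_mul2l le_wm orbT.
  lia.
move=> b [ks [-> le_ks sum_ks]]; exists ks; split=> //.
  by apply: leq_trans le_ks _; rewrite -cardE.
rewrite sum_ks big_enum /=; apply/rowP=> k; rewrite summxE !mxE.
by apply: eq_bigr => v _; rewrite mxE.
Qed.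

(** The rows of a simplex without triple are zero because f and phi vanish on it
by convention.  The length of ks enters the cost of lookups and substitution. *)
Record reduced i (ks : seq 'I_m) (F Phi : 'M['F_2]_m) : Prop := Reduced {
  reduced_pc : partial_contraction D i F Phi;
  reduced_F : forall k, homog #|S k| (row k F);
  reduced_Phi : forall k, homog #|S k|.+1 (row k Phi);
  reduced_size : (size ks <= i)%N;
  reduced_lt : forall k, k \in ks -> (k < i)%N;
  reduced_out : forall k, k \notin ks -> row k F = 0 /\ row k Phi = 0
}.

Lemma reduced0 : reduced 0 [::] 0 0.
Proof.
have homog0 n : homog n (0 : 'rV['F_2]_m) by apply/homogP=> k; rewrite mxE eqxx.
split; first exact: pc0.
1,2: by move=> k; rewrite row0.
1,2: by [].
by move=> k _; rewrite !row0.
Qed.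

Let lower := boundary_mx_lower sorted_s.
Let DD := boundary_boundary sorted_s.

Lemma row_add_delta_ii (F : 'M['F_2]_m) (i k : 'I_m) :
  row k (F + delta_mx i i) = row k F + (k == i)%:R *: delta_mx 0 i.
Proof. by rewrite rowE mulmxDr mul_delta_ii mxE eqxx [k == i]eq_sym -rowE. Qed.

Lemma row_add_col (M F : 'M['F_2]_m) (j k : 'I_m) (a : 'rV_m) :
  row k (M + col j F *m a) = row k M + F k j *: a.
Proof. by rewrite rowE mulmxDr mul_col_row -!rowE mxE. Qed.

Lemma reduced_row_i (i : 'I_m) ks F Phi : reduced i ks F Phi ->
  row i F = 0 /\ row i Phi = 0.
Proof.
move=> R; apply: (reduced_out R).
by apply/negP=> /(reduced_lt R); rewrite ltnn.
Qed.

Lemma reduced_new (i : 'I_m) ks F Phi : reduced i ks F Phi ->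
  row i D *m F = 0 -> reduced i.+1 (i :: ks) (F + delta_mx i i) Phi.
Proof.
move=> R fd0; have [Fi Phii] := reduced_row_i R; split.
- by apply: pc_new_generator (reduced_pc R) _ => //; rewrite -rowE.
- move=> k; rewrite row_add_delta_ii; apply: homogD; first exact: reduced_F R _.
  apply: homogZ; case: (k =P i) => [-> _ | //]; exact: homog_delta.
- exact: reduced_Phi R.
- exact: (reduced_size R).
- move=> k; rewrite inE => /predU1P[-> // | /(reduced_lt R)].
  exact: leqW.
- move=> k; rewrite inE negb_or row_add_delta_ii => /andP[/negPf->].
  by move=> /(reduced_out R)[-> ->]; rewrite scale0r addr0.
Qed.

Lemma reduced_eliminate (i j : 'I_m) ks F Phi a b : reduced i ks F Phi ->
    a = row i D *m F -> b = delta_mx 0 i + row i D *m Phi -> a 0 j != 0 ->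
  reduced i.+1 ks (F + col j F *m a) (Phi + col j F *m b).
Proof.
move=> R aE bE aj; have ha : homog #|S i|.-1 a.
  rewrite aE; apply: (homog_mul (h := id) (reduced_F R)).
  exact: homog_boundary.
have hb : homog #|S i| b.
  rewrite bE; apply: homogD; first exact: homog_delta.
  rewrite -[#|S i|](prednK (card_simplex_gt0 sorted_s i)).
  by apply: (homog_mul (h := succn) (reduced_Phi R)); apply: homog_boundary.
have Fkj k : F k j != 0 -> #|S k| = #|S i|.-1.
  move=> Fkj; rewrite -(homogP _ _ ha j aj).
  by rewrite -(homogP _ _ (reduced_F R k) j) // mxE.
split.
- by apply: (pc_eliminate lower DD (reduced_pc R) _ _ aj); rewrite -rowE.
- move=> k; rewrite row_add_col; apply: homogD; first exact: reduced_F R _.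
  by apply: homogZ => /Fkj->.
- move=> k; rewrite row_add_col; apply: homogD; first exact: reduced_Phi R _.
  by apply: homogZ => /Fkj->; rewrite (prednK (card_simplex_gt0 sorted_s i)).
- exact: leqW (reduced_size R).
- by move=> k /(reduced_lt R)/leqW.
- move=> k k_out; have [Fk Phik] := reduced_out R k_out.
  have Fkj0 : F k j = 0.
    by have := congr1 (fun v : 'rV__ => v 0 j) Fk; rewrite !mxE.
  by rewrite !row_add_col Fk Phik Fkj0 !scale0r !addr0.
Qed.

(** This bounds 2m + 2 + w (8m + 6) for the width w <= 4m: a boundary has at
most w terms, each with one lookup and three additions. *)
Definition eval_cost := (32 * (m * m) + 26 * m + 2)%N.

Lemma spec_eval ks F P G (b : seq 'I_m) :
    (size ks <= m)%N -> (size b <= width)%N ->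
    (forall k : 'I_m, k \notin ks ->
       [/\ row k F = 0, row k P = 0 & row k G = 0]) ->
  spec (evalT input (encode ks F P G) (map val b)) eval_cost
    (eq (bits (chain_sum b *m F), bits (chain_sum b *m P),
         bits (chain_sum b *m G))).
Proof.
move=> szks szb out; apply: spec_le (spec_evalT _ _ szks out) _.
rewrite /eval_cost; have := width_le.
move: (size b) width szb => n w le_nw le_wm.
have : (n * (m * 8 + 5).+1 <= 4 * m * (m * 8 + 5).+1)%N.
  by rewrite leq_mul2r (leq_trans le_nw le_wm) orbT.
lia.
Qed.

(** The boundary, its images under f and phi, two more passes over m entries,
and at most 10 m^2 + 13 m + 6 for the substitution. *)
Definition step_cost := (62 * (m * m) + 63 * m + 11)%N.

Variable pick : nat -> seq nat -> nat.
Hypothesis pick_valid : valid_pick pick.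

(** The symbolic part, the fourth argument of [encode], is f again. *)
Definition state i (l : seq triple) : Prop :=
  exists ks F Phi, l = encode ks F Phi F /\ reduced i ks F Phi.

Lemma spec_stepT (i : 'I_m) l : state i l ->
  spec (stepT pick input (val i, enum (S i)) l) step_cost (state i.+1).
Proof.
case=> ks [F] [Phi] [-> R]; have szks : (size ks <= m)%N.
  by apply: leq_trans (reduced_size R) _; rewrite ltnW.
apply: (@spec_le _ _ (boundary_cost + (eval_cost + (m * 2 + 1 + (m * 2 + 1 +
  (10 * (m * m) + 13 * m + 6)))))); last first.
  by rewrite /step_cost /boundary_cost /eval_cost; lia.
apply: (spec_bind (spec_boundaryT i)) => _ [b [-> szb sum_b]].
apply: spec_bindE (spec_eval szks szb _) _.
  by move=> k /(reduced_out R)[-> ->].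
rewrite sum_b /=; set a := row i D *m F.
apply: (spec_bind (spec_support_bits a)) => js [js_supp js_nil].
apply: (spec_bindE (spec_unitT _ i)).
case: js js_supp js_nil => [_ /(_ erefl) a0 | j0 js js_supp _].
  apply: spec_le.
    apply: (spec_bindE (spec_zeroT _)); apply: spec_op.
    exists (i :: ks), (F + delta_mx i i), Phi; split; last exact: reduced_new.
    have [Fi Phii] := reduced_row_i R.
    rewrite /encode /= row_add_delta_ii Fi Phii eqxx scale1r add0r.
    congr (_ :: _); apply/eq_in_map => k ks_k; rewrite row_add_delta_ii.
    have := reduced_lt R ks_k; case: eqP => [-> | _]; first by rewrite ltnn.
    by rewrite scale0r addr0.
  by lia.
have [j def_j aj] : exists2 j : 'I_m, pick i (j0 :: js) = j & a 0 j != 0.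
  exact: js_supp (pick_valid _ _).
rewrite def_j.
pose b' := delta_mx 0 i + row i D *m Phi.
apply: spec_le.
  apply: (spec_bindE (spec_op erefl)).
  apply: (spec_bindE (spec_clear_bits aj)).
  apply: (spec_bindE (spec_add_bits _ _)); rewrite [_ + delta_mx 0 i]addrC -/b'.
  apply: (spec_bindE (spec_clear_bits aj)).
  pose F' := F + col j F *m a; pose Phi' := Phi + col j F *m b'.
  pose new (k : 'I_m) :=
    Triple k (bits (row k F')) (bits (row k Phi')) (bits (row k F')).
  apply: spec_weaken (@spec_mapT _ _ _ _ _ new (m * 10 + 8)%N ks _) _ _ => //.
    move=> k; rewrite /new !row_add_col.
    have := spec_substT k (row k F) (row k Phi) a b' j.
    by have -> : row k F 0 j = F k j by rewrite mxE.
  move=> _ <-; exists ks, F', Phi'.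
  by split; [exact: erefl | exact: (reduced_eliminate R erefl erefl aj)].
have : (size ks * (m * 10 + 8).+1 <= m * (m * 10 + 8).+1)%N.
  by rewrite leq_mul2r szks orbT.
by move: (size ks * _)%N => P; lia.
Qed.

Lemma spec_cyclesT ks F Phi : reduced m ks F Phi ->
  spec (cyclesT input (encode ks F Phi 0)) (m * (52 * (m * m) + 54 * m + 9) + 1)
    (fun g => forall k : 'I_m, [seq p.2 | p <- g & p.1 == k :> nat] =
       if row k F == delta_mx 0 k then [:: bits (delta_mx 0 k + row k D *m Phi)]
       else [::]).
Proof.
move=> R; have szks := reduced_size R.
pose J n (g : seq (nat * bitseq)) := forall k : 'I_m,
  [seq p.2 | p <- g & p.1 == k :> nat] =
  if (k < n)%N && (row k F == delta_mx 0 k)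
  then [:: bits (delta_mx 0 k + row k D *m Phi)] else [::].
pose c := (52 * (m * m) + 54 * m + 8)%N.
apply: spec_weaken (@spec_fold_ord _ _ _ _ _ J c _ _ _) _ _.
- by move=> k.
- move=> k g Jg; pose gen := row k F == delta_mx 0 k.
  have ltS (l : 'I_m) : (l < k.+1)%N = (l == k) || (l < k)%N.
    by rewrite ltnS leq_eqVlt.
  have Jskip : ~~ gen -> J k.+1 g.
    move=> Ngen l; rewrite Jg ltS.
    have [-> | neq_lk] := eqVneq l k; last by [].
    by rewrite (negPf Ngen : (row k F == delta_mx 0 k) = false) !andbF.
  apply: spec_le.
    apply: (spec_bindE (spec_lookup _ _ _ _ _)) => /=.
    instantiate (1 := (52 * (m * m) + 52 * m + 7)%N).
    case: ifPn => [_ | k_out]; last first.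
      apply: spec_le (spec_ret _) _ => //; apply: Jskip; rewrite /gen.
      have [-> _] := reduced_out R k_out; apply/eqP=> /rowP/(_ k)/esym/eqP.
      by rewrite !mxE !eqxx oner_eq0.
    apply: spec_le.
      apply: (spec_bindE (spec_unitT _ k)).
      apply: (spec_bindE (spec_eq_bits _ _)); rewrite -/gen.
      instantiate (1 := (52 * (m * m) + 48 * m + 5)%N).
      case: ifPn => [gen_k | /Jskip]; last first.
        by move=> Jg'; apply: spec_le (spec_ret Jg') _.
      apply: spec_le.
        apply: (spec_bind (spec_boundaryT k)) => _ [b [-> szb sum_b]].
        apply: spec_bindE (spec_eval szks szb _) _.
          by move=> l /(reduced_out R)[-> ->]; rewrite row0.
        apply: (spec_bindE (spec_add_bits _ _)); rewrite sum_b; apply: spec_op.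
        move=> l; rewrite ltS /=.
        have gen_kE : (row k F == delta_mx 0 k) = true := gen_k.
        have [-> | neq_lk] := eqVneq l k.
          by rewrite gen_kE eqxx /= Jg ltnn.
        by rewrite -[k == l :> nat]/(k == l) eq_sym (negPf neq_lk) /= Jg.
      by rewrite /boundary_cost /eval_cost; lia.
    by lia.
  by lia.
- by rewrite leq_add2r leq_mul2l; apply/orP; right; lia.
by move=> g Jg k; rewrite Jg ltn_ord.
Qed.

Definition algorithm_cost :=
  (m * 2 + 1 + (m * step_cost.+1 + 1 +
     (m * (m * 2 + 3) + 1 + (m * (52 * (m * m) + 54 * m + 9) + 1))))%N.

Lemma spec_algorithm :
  spec (algorithm pick (simplex_lists s)) algorithm_cost
    (fun r => exists ks F Phi, [/\ reduced m ks F Phi, r.1 = encode ks F Phi 0 &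
      forall k : 'I_m, [seq p.2 | p <- r.2 & p.1 == k :> nat] =
        if row k F == delta_mx 0 k
        then [:: bits (delta_mx 0 k + row k D *m Phi)] else [::]]).
Proof.
rewrite /algorithm_cost; have := spec_numberT 0 (simplex_lists s).
rewrite size_map numberT_input => num; apply: spec_bindE num _.
apply: spec_bind (@spec_fold_ord _ _ _ _ _ state step_cost _ _ _) _.
- by exists [::], 0, 0; split; last exact: reduced0.
- by move=> k l; apply: spec_stepT.
move=> _ [ks [F [Phi [-> R]]]].
have szks : (size ks <= m)%N := reduced_size R.
apply: spec_bindE.
  pose out (k : 'I_m) :=
    Triple k (bits (row k F)) (bits (row k Phi)) (bits (row k (0 : 'M_m))).
  apply: spec_le (@spec_mapT _ _ _ _ _ out (m * 2 + 2)%N ks _) _.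
    move=> k; rewrite /out row0; apply: spec_le.
      by apply: (spec_bindE (spec_zeroT _)); apply: spec_op.
    by lia.
  by rewrite leq_add2r leq_mul //; lia.
apply: spec_le.
  apply: (spec_bind (spec_cyclesT R)) => g gE; apply: spec_ret.
  by exists ks, F, Phi; split.
by rewrite addn0.
Qed.

End Run.

(** * The contraction computed by the algorithm *)

Section Output.
Variables (V : finType) (K : simplicial_complex V) (s : seq {set V}).
Hypothesis sorted_s : sorted_simplices K s.
Local Notation m := (size s).
Local Notation S := (@nth_simplex V s).
Local Notation D := (boundary_mx s).
Variables (ks : seq 'I_m) (F Phi : 'M['F_2]_m).
Hypothesis R : reduced m ks F Phi.
Variable r : seq triple * seq (nat * bitseq).
Hypothesis r1E : r.1 = encode ks F Phi 0.
Hypothesis r2E : forall k : 'I_m, [seq p.2 | p <- r.2 & p.1 == k :> nat] =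
  if row k F == delta_mx 0 k
  then [:: bits (delta_mx 0 k + row k D *m Phi)] else [::].

Local Notation ix := (simplex_index sorted_s).
Let pc := reduced_pc R.

Lemma full_pid (x : 'rV['F_2]_m) : x *m pid_mx m = x.
Proof. by rewrite pid_mx_1 mulmx1. Qed.

(** Both sides are P x, the left one by definition and the right one as the
composite of f with tau |-> tau + phi d tau. *)
Lemma homotopy_mx (x : 'rV['F_2]_m) :
  x + (x *m Phi *m D + x *m D *m Phi) = x *m F + x *m F *m D *m Phi.
Proof.
by have := pc_homotopy pc x; rewrite full_pid => <-; rewrite -addrA addvK.
Qed.

Lemma boundary_F (x : 'rV['F_2]_m) : x *m D *m F = 0.
Proof. by have := pc_fd pc x; rewrite full_pid. Qed.

Definition phi_map q (c : schain K q) : schain K q.+1 :=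
  prj sorted_s q.+1 (emb c *m Phi).

Fact phi_map_linear q : linear (@phi_map q).
Proof.
by move=> a c d; rewrite /phi_map linearP mulmxDl -scalemxAl linearP.
Qed.
HB.instance Definition _ q := GRing.isLinear.Build 'F_2
  (schain K q) (schain K q.+1) _ (@phi_map q) (@phi_map_linear q).

Definition f_map q (c : schain K q) : schain K q := prj sorted_s q (emb c *m F).

Fact f_map_linear q : linear (@f_map q).
Proof. by move=> a c d; rewrite /f_map linearP mulmxDl -scalemxAl linearP. Qed.
HB.instance Definition _ q := GRing.isLinear.Build 'F_2
  (schain K q) (schain K q) _ (@f_map q) (@f_map_linear q).

Lemma emb_phi q (c : schain K q) : emb (phi_map c) = emb c *m Phi.
Proof.
rewrite prjK //; apply: (homog_mul (h := succn) (reduced_Phi R)).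
exact: homog_emb.
Qed.

Lemma emb_f q (c : schain K q) : emb (f_map c) = emb c *m F.
Proof.
rewrite prjK //; apply: (homog_mul (h := id) (reduced_F R)).
exact: homog_emb.
Qed.

Lemma emb_inj q : injective (@emb V K s q).
Proof. exact: can_inj (embK sorted_s (q := q)). Qed.

Local Notation C := (simplicial_chains K).
Definition phi : homotopy_on C := fun q => @phi_map q.

Lemma emb_homotopy_bd q (c : schain K q) :
  emb (homotopy_bd phi c : schain K q) = emb c *m D *m Phi.
Proof.
case: q c => [|q] c /=; last by rewrite emb_phi (emb_bd sorted_s).
by rewrite linear0 (homog1_boundary sorted_s (homog_emb _ _)) mul0mx.
Qed.

Lemma emb_hproj q (c : schain K q) :
  emb (hproj phi c : schain K q) = emb c *m F + emb c *m F *m D *m Phi.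
Proof.
rewrite -homotopy_mx /hproj !linearD /= (emb_bd sorted_s) emb_phi.
by rewrite emb_homotopy_bd.
Qed.

(** At a boundary, the homotopy identity loses the terms with f d and d d. *)
Lemma bd_phi_bd q (c : C q.+1) : bd C q (phi q (bd C q c)) = bd C q c.
Proof.
apply: emb_inj; rewrite /= !(emb_bd sorted_s) emb_phi (emb_bd sorted_s).
have := homotopy_mx (emb c *m D).
rewrite boundary_F (boundary_boundary sorted_s) !mul0mx !addr0 => /eqP.
by rewrite addrC -[X in _ == X](addvv (emb c *m D)) (inj_eq (addIr _)) => /eqP.
Qed.

(** At a value of phi, the homotopy identity loses the terms with f phi and
phi phi. *)
Lemma phi_bd_phi q (c : C q) : phi q (bd C q (phi q c)) = phi q c.
Proof.
apply: emb_inj; rewrite /= emb_phi (emb_bd sorted_s) emb_phi.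
have := homotopy_mx (emb c *m Phi).
rewrite (pc_fphi pc) (pc_phiphi pc) !mul0mx add0r addr0 => /eqP.
by rewrite addrC -[X in _ == X](addvv (emb c *m Phi)) (inj_eq (addIr _)) => /eqP.
Qed.

Lemma phi_phi q (c : C q) : phi q.+1 (phi q c) = 0.
Proof. by apply: emb_inj; rewrite /= !emb_phi (pc_phiphi pc) linear0. Qed.

Lemma hproj_f q (c : schain K q) :
  hproj phi (f_map c : C q) = hproj phi (c : C q).
Proof. by apply: emb_inj; rewrite !emb_hproj emb_f !(pc_ff pc). Qed.

Lemma f_hproj q (c : schain K q) : f_map (hproj phi (c : C q)) = f_map c.
Proof.
apply: emb_inj; rewrite !emb_f emb_hproj mulmxDl (pc_ff pc) (pc_fphi pc).
by rewrite addr0.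
Qed.

Lemma image_bitsE (part : triple -> bitseq) (M : 'M['F_2]_m) q
    (x : simplex K q) :
    (forall k : 'I_m,
       part (Triple k (bits (row k F)) (bits (row k Phi))
                      (bits (row k (0 : 'M_m)))) = bits (row k M)) ->
    (forall k, k \notin ks -> row k M = 0) ->
  image_bits s r part x = bits (row (ix x) M).
Proof.
move=> partE out; rewrite /image_bits r1E -[index _ _]/(val (ix x)).
set k := ix x; have := out k; elim: (ks) => [|l ls IHls] /=.
  move=> -> //; apply/esym/bitsP => [|l]; first by rewrite size_nseq.
  by rewrite nth_nseq ltn_ord mxE eqxx.
rewrite inE negb_or -[l == k :> nat]/(l == k) eq_sym.
by have [-> _ | ] := eqVneq l k; first exact: partE.
Qed.

Lemma generatorE q (x : simplex K q) :
  is_generator s r x = (row (ix x) F == delta_mx 0 (ix x)).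
Proof.
rewrite /is_generator (@image_bitsE f_of F) //.
  by rewrite bits_emb // emb_basis (inj_eq (@bits_inj _)).
by move=> k /(reduced_out R)[].
Qed.

Lemma coef_f_generator q (c : schain K q) y :
  coefficient (f_map c) y != 0 -> is_generator s r y.
Proof.
rewrite -(embE sorted_s) emb_f generatorE => /(pc_gen_row pc)->.
by [].
Qed.

Lemma f_generator q (y : simplex K q) :
  is_generator s r y -> f_map (basis_chain y) = basis_chain y.
Proof.
rewrite generatorE => /eqP gen_y; apply: emb_inj.
by rewrite emb_f (emb_basis sorted_s) -rowE gen_y.
Qed.

Definition cycle_rep q (y : simplex K q) : cycle_space C q :=
  hproj_cyc phi (basis_chain y : C q).

Lemma f_sum q (c : schain K q) :
  f_map c =
  \sum_(y | is_generator s r y) coefficient (f_map c) y *: basis_chain y.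
Proof.
rewrite {1}[f_map c]schain_sum [RHS]big_mkcond; apply: eq_bigr => y _.
case: ifPn => // /negPf ngen.
have [-> | /coef_f_generator] := eqVneq (coefficient (f_map c) y) 0.
  by rewrite scale0r.
by rewrite ngen.
Qed.

Lemma to_homology_sum q (c : schain K q) :
  to_homology phi (c : C q) =
  \sum_(y | is_generator s r y) coefficient (f_map c) y *: hclass (cycle_rep y).
Proof.
have -> : to_homology phi (c : C q) = to_homology phi (f_map c : C q).
  congr hclass; apply: val_inj; rewrite /= !(hproj_cycE bd_phi_bd).
  by rewrite hproj_f.
rewrite [in LHS]f_sum linear_sum; apply: eq_bigr => y _.
by rewrite linearZ.
Qed.

Lemma represents_cycle q (y : simplex K q) :
  g_bits s r y =
  if is_generator s r y then [:: chain_bits s (vsval (cycle_rep y))] else [::].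
Proof.
rewrite /g_bits -[index _ _]/(val (ix y)) (r2E (ix y)) generatorE.
case: eqP => // gen_y.
rewrite bits_emb // (hproj_cycE bd_phi_bd) emb_hproj (emb_basis sorted_s).
by rewrite -[delta_mx 0 (ix y) *m F]rowE gen_y -rowE.
Qed.

(** The cycles span because f x is a sum of generators for every cycle x.  They
are independent because f sends the cycle of a generator y back to y, so that
the coefficient of y can be read off. *)
Lemma generator_basis q :
  basis_of fullv
    [seq hclass (cycle_rep y) | y <- enum (@is_generator V K s r q)].
Proof.
rewrite /basis_of; apply/andP; split.
  apply/eqP/vspaceP=> h; rewrite memvf; have [z ->] := hclass_surj h.
  rewrite -(hclass_hproj bd_phi_bd) -/(to_homology phi _) to_homology_sum.
  apply: memv_suml => y gen_y; apply/memvZ/memv_span/map_f.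
  by rewrite mem_enum.
pose gens := enum_tuple (@is_generator V K s r q).
pose t := map_tuple (fun y => hclass (cycle_rep y)) gens.
rewrite -[map _ _]/(tval t); apply/freeP => k k0 j.
pose y i := tnth gens i.
have gen i : is_generator s r (y i).
  by have := mem_tnth i gens; rewrite mem_enum.
pose g := from_hom bd_phi_bd q.
have gE i : f_map (g (hclass (cycle_rep (y i)))) = basis_chain (y i).
  rewrite [g _](from_homologyE bd_phi_bd) (hproj_cycE bd_phi_bd) !f_hproj.
  by rewrite f_generator.
have: f_map (g (\sum_i k i *: t`_i)) = 0 by rewrite k0 (linear0 g) linear0.
have -> : f_map (g (\sum_i k i *: t`_i)) = \sum_i k i *: basis_chain (y i).
  rewrite !linear_sum; apply: eq_bigr => i _.
  by rewrite -tnth_nth tnth_map !linearZ /=; congr (_ *: _); apply: gE.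
move=> /(congr1 (fun c => coefficient c (y j))).
rewrite /coefficient ffunE sum_ffunE.
rewrite (bigD1 j) //= big1 => [|i neq_ij].
  by rewrite !ffunE eqxx addr0 [_ *: _]mulr1.
have /tuple_uniqP y_inj : uniq gens by exact: enum_uniq.
by rewrite !ffunE (inj_eq y_inj) eq_sym (negPf neq_ij) scaler0.
Qed.

Theorem output_correct : computes_homology_contraction K s r.
Proof.
exists (to_hom phi), (from_hom bd_phi_bd), phi.
exists (fun q x => f_map (basis_chain x)), cycle_rep.
split.
  exact: (splitting_homotopy_contraction bd_phi_bd phi_bd_phi phi_phi).
split.
- move=> q x; rewrite (@image_bitsE f_of F) //; last first.
    by move=> k /(reduced_out R)[].
  by rewrite bits_emb // emb_f (emb_basis sorted_s) -rowE.
- by move=> q x y; apply: coef_f_generator.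
- by move=> q x; apply: to_homology_sum.
- move=> q x; rewrite (@image_bitsE phi_of Phi) //; last first.
    by move=> k /(reduced_out R)[].
  by rewrite bits_emb // emb_phi (emb_basis sorted_s) -rowE.
- exact: represents_cycle.
- move=> q y _; rewrite /= (from_homologyE bd_phi_bd) (hproj_cycE bd_phi_bd).
  exact: hprojK bd_phi_bd phi_bd_phi phi_phi _ _.
- exact: generator_basis.
Qed.

End Output.

Close Scope ring_scope.

Theorem theorem3 :
  (forall (V : finType) (K : simplicial_complex V) (s : seq {set V})
      (pick : nat -> seq nat -> nat),
    sorted_simplices K s -> valid_pick pick ->
    computes_homology_contraction K s
      (result (algorithm pick (simplex_lists s)))) /\
  (exists c m0 : nat,
    forall (m : nat) (V : finType) (K : simplicial_complex V)
      (s : seq {set V}) (pick : nat -> seq nat -> nat),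
    m = #|simplices K| -> sorted_simplices K s -> valid_pick pick ->
    m0 <= m ->
    cost (algorithm pick (simplex_lists s)) <= c * m ^ 3).
Proof.
split=> [V K s pick sorted_s pick_valid | ].
  have [[ks [F [Phi [R r1E r2E]]]] _] := spec_algorithm sorted_s pick_valid.
  exact: (output_correct sorted_s R r1E r2E).
(* The cost is at most 114 m^3 + 119 m^2 + 26 m + 4; the coefficients add up
   to 263. *)
exists 263, 1 => m V K s pick -> sorted_s pick_valid.
have [_ le_cost] := spec_algorithm sorted_s pick_valid.
rewrite (card_simplices sorted_s) => m_gt0; apply: leq_trans le_cost _.
rewrite /algorithm_cost /step_cost; move: (size s) m_gt0 => n n_gt0.
rewrite !expnS expn0 muln1.
have : n * n <= n * (n * n) by rewrite leq_pmull.
have : n <= n * n by rewrite leq_pmull.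
lia.
Qed.
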